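(* Let $n\ge 2$, $d\ge 1$, let $\mathbf r=(r_1,\dots,r_n)^T$ be a strictly positive stochastic vector, and let the random process $\{\mathbf x_i(t)\}_{t\ge 1}$, $i\in[n]$, be generated by the dynamics $$\mathbf x_i(t+1)=(1-\beta(t))\,\mathbf x_i(t)+\beta(t)\,\hat{\mathbf x}_i(t)-\alpha(t)\,\mathbf g_i(\mathbf x_i(t)),\qquad \hat{\mathbf x}_i(t)=\sum_{j=1}^n W_{ij}(t)\,\mathbf x_j(t)+\mathbf e_i(t),\qquad t\ge 1,$$ with the objects described in the context and with step-sizes $\alpha(t)=\frac{\alpha_0}{t^{\nu}}$ and $\beta(t)=\frac{\beta_0}{t^{\mu}}$, where $\alpha_0>0$ and $\beta_0>0$. Suppose the Noise, Connectivity and Objective Function Assumptions listed in the context hold. If $\beta_0\le1$, $\frac12<\mu\le1$ and $\frac12(1+\mu)<\nu\le1$, then there is a (random) point $\tilde{\mathbf x}$ such that, almost surely, $\tilde{\mathbf x}\in\mathcal X^\star$ and $\lim_{t\to\infty}\mathbf x_i(t)=\tilde{\mathbf x}$ for every $i\in[n]$, where $\mathcal X^\star=\arg\min_{\mathbf x\in\mathbb R^d}\sum_{i=1}^n r_i f_i(\mathbf x)$.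
   Context: Notation: $[n]=\{1,\dots,n\}$; $\|\cdot\|$ is the Euclidean norm on $\mathbb R^d$; $\mathbf 1\in\mathbb R^n$ is the all-one column vector. A stochastic vector has nonnegative entries summing to $1$. Setting: there are $n\ge 2$ agents. For each $t\ge1$, $\mathcal G(t)=([n],\mathcal E(t))$ is a directed graph with $\mathcal E(t)\subseteq[n]\times[n]$, and $W(t)=[W_{ij}(t)]$ is a (deterministic) row-stochastic $n\times n$ matrix with $W_{ij}(t)>0$ if and only if $(j,i)\in\mathcal E(t)$. Each agent $i$ has a local cost function $f_i:\mathbb R^d\to\mathbb R$, and $\mathbf g_i(\mathbf x)$ denotes a subgradient of $f_i$ at $\mathbf x$. The $\mathbf e_i(t)$ are random noise vectors in $\mathbb R^d$. The initial vectors $\mathbf x_i(1)\in\mathbb R^d$ are arbitrary and deterministic. $X(t)$ is the $n\times d$ matrix with rows $\mathbf x_1(t),\dots,\mathbf x_n(t)$, and $\{\mathcal F_t\}$ is the natural filtration of the random process $\{X(t)\}$. Noise Assumption: there is $\gamma>0$ such that $\mathbb E[\mathbf e_i(t)\mid\mathcal F_t]=0$ and $\mathbb E[\|\mathbf e_i(t)\|^2\mid\mathcal F_t]\le\gamma$ for all $i\in[n]$ and $t\ge1$. Connectivity Assumption: (a) $W(t)$ is nonnegative, $W(t)\mathbf 1=\mathbf 1$ and $\mathbf r^TW(t)=\mathbf r^T$ for all $t\ge1$, where $\mathbf r>0$ is the given stochastic weight vector. (b) There is $\eta>0$ such that whenever $W_{ij}(t)>0$ (for $i,j\in[n]$, $t\ge1$),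 then $W_{ij}(t)\ge\eta$. (c) There is an integer $B\ge1$ such that the graph $\big([n],\bigcup_{k=t+1}^{t+B}\mathcal E(k)\big)$ is strongly connected for all $t\ge1$. Objective Function Assumption: (a) each $f_i$ is convex; (b) $\mathcal X^\star=\arg\min_{\mathbf x\in\mathbb R^d}\sum_{i=1}^n r_if_i(\mathbf x)$ is non-empty; (c) there is $L>0$ such that $\|\mathbf g\|<L$ for every $i$, every $\mathbf x\in\mathbb R^d$ and every subgradient $\mathbf g$ of $f_i$ at $\mathbf x$. *)

(* Defs.v *)
From HB Require Import structures.
From mathcomp Require Export all_boot all_order all_algebra.
From mathcomp Require Export all_classical all_reals all_analysis.
Set Implicit Arguments.
Unset Strict Implicit.
Unset Printing Implicit Defensive.
Import Order.TTheory GRing.Theory Num.Theory.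
Export numFieldNormedType.Exports.
Local Open Scope classical_set_scope.
Local Open Scope ring_scope.

Section Euclidean.
Variables (R : realType) (d : nat).
Implicit Types (u v : 'rV[R]_d) (f : 'rV[R]_d -> R).

Definition dotv u v : R := \sum_(k < d) u 0 k * v 0 k.

(* The library norm on 'rV[R]_d is the sup norm, hence this definition. *)
Definition enorm u : R := Num.sqrt (dotv u u).

Definition is_subgradient f u v := forall y, f u + dotv v (y - u) <= f y.

Definition argmin f : set 'rV[R]_d := [set u | forall y, f u <= f y].

End Euclidean.

Section Probability.
Context {disp : measure_display} {T : measurableType disp} {R : realType}.

(* Measurability for the Borel sigma-algebra of R^(m x n), which is the product
   sigma-algebra and is therefore tested entrywise. *)
Definition random_matrix (m n : nat) (Y : T -> 'M[R]_(m, n)) :=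
  forall i j, measurable_fun [set: T] (fun w => Y w i j).

(* sigma(Y 1, ..., Y t), the process being indexed from time 1; it is generated
   by the events {Y s i j \in B} with 1 <= s <= t and B Borel. *)
Definition natural_filtration (m n : nat) (Y : nat -> T -> 'M[R]_(m, n))
    (t : nat) : set (set T) :=
  <<s [set A | exists s i j (B : set R), [/\ (0 < s <= t)%N, measurable B &
         A = (fun w => Y s w i j) @^-1` B]] >>.

(* Y is a version of E[Z | G]. *)
Definition is_cond_expectation (P : probability T R) (G : set (set T))
    (Z Y : T -> R) :=
  [/\ P.-integrable [set: T] (EFin \o Z),
      P.-integrable [set: T] (EFin \o Y),
      (forall B : set R, measurable B -> G (Y @^-1` B)) &
      (forall A, G A ->
         (\int[P]_(w in A) (Z w)%:E = \int[P]_(w in A) (Y w)%:E)%E)].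

(* Versions of a conditional expectation agree almost surely, so the bound on
   E[ ||e||^2 | F_t ] is imposed on one of them; E[ e | F_t ] is taken
   coordinatewise. *)
Definition noise_assumption (P : probability T R) (n d : nat)
    (F : nat -> set (set T)) (e : nat -> 'I_n -> T -> 'rV[R]_d) :=
  exists2 gamma : R, 0 < gamma & forall (i : 'I_n) (t : nat), (0 < t)%N ->
    (forall k, is_cond_expectation P (F t) (fun w => e t i w 0 k) (cst 0)) /\
    (exists2 Y : T -> R,
       is_cond_expectation P (F t) (fun w => enorm (e t i w) ^+ 2) Y &
       {ae P, forall w, Y w <= gamma}).

End Probability.

(* A pair (i, j) in the edge set is an edge from i to j. *)
Definition strongly_connected (n : nat) (E : {set 'I_n * 'I_n}) :=
  forall i j, connect [rel u v | (u, v) \in E] i j.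

Definition connectivity_assumption (R : realType) (n : nat)
    (W : nat -> 'M[R]_n) (E : nat -> {set 'I_n * 'I_n}) (r : 'cV[R]_n) :=
  [/\ (forall t, (0 < t)%N ->
         [/\ forall i j, 0 <= W t i j,
             W t *m const_mx 1 = const_mx 1 :> 'cV[R]_n &
             r^T *m W t = r^T]),
      (exists2 eta : R, 0 < eta & forall i j t, (0 < t)%N ->
         0 < W t i j -> eta <= W t i j) &
      (exists2 B : nat, (0 < B)%N & forall t, (0 < t)%N ->
         strongly_connected (\bigcup_(t.+1 <= k < (t + B).+1) E k)%SET)].

Definition global_cost (R : realType) (n d : nat) (r : 'cV[R]_n)
    (f : 'I_n -> 'rV[R]_d -> R) : 'rV[R]_d -> R :=
  fun u => \sum_(i < n) r i 0 * f i u.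

Definition objective_assumption (R : realType) (n d : nat) (r : 'cV[R]_n)
    (f : 'I_n -> 'rV[R]_d -> R) :=
  [/\ (forall i, convex_function (E := 'rV[R]_d) setT (f i)),
      argmin (global_cost r f) !=set0 &
      (exists2 L : R, 0 < L & forall i u v,
         is_subgradient (f i) u v -> enorm v < L)].

(* Main.v *)
Require Import Defs.
From mathcomp Require Import measurable_realfun ring lra zify.
Set Implicit Arguments.
Unset Strict Implicit.
Unset Printing Implicit Defensive.
Import Order.TTheory GRing.Theory Num.Theory.
Local Open Scope classical_set_scope.
Local Open Scope ring_scope.

(** Write V_c(t) for the r-weighted sum of |x_i(t) - c|^2, q(t) for the sum of
    r_i W_ij(t) |x_i(t) - x_j(t)|^2, D(t) for the r-weighted sum of
    |x_i(t) - x_i0(t)|^2 with a fixed agent i0, and F for the global cost.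

    One step.  As r is stationary for W(t), averaging does not increase V_c, and
    once beta(t) <= 1/2 it decreases V_c by a fixed fraction of beta(t) q(t), the
    variance lost in the average ([mixed_dissipation]).  The subgradient step
    brings in -2 alpha(t) (F(x_i0(t)) - F(c)) and an error alpha(t) sqrt(D(t)),
    which Young's inequality splits into delta beta(t) D(t) and a multiple of
    alpha(t)^2 / beta(t); the noise adds a term linear in e(t), orthogonal to
    the past, and a term beta(t)^2 |e(t)|^2 ([descent]).  The assumptions on mu
    and nu say exactly that beta^2 and alpha^2 / beta are summable.

    Consensus error.  The term delta beta D is paid for by the dissipation: over
    B steps the graph is connected, every edge used controls the distance of its
    two ends by the q of its time, and meanwhile the agents move little; so D(t)
    is bounded by a constant times the q, beta^2 |e|^2 and alpha^2 of the B
    preceding steps ([disagreement_window]).  For delta small the mean dissipation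
    absorbs the mean of delta beta D ([absorb_windows]), and taking expectations
    at a minimizer c shows that the series of the means of beta D and of
    alpha (F(x_i0) - F(c)) converge ([mean_bounds]).

    Almost sure convergence.  The selection g of subgradients is an arbitrary
    function, so e(t) need not be measurable with respect to the past of X at any
    later time, and the noise terms need not form a martingale adapted to that
    filtration.  The process V_c is adapted, though, and its integral over an
    event of the past grows by at most a summable amount, uniformly in the event;
    Doob's upcrossing argument only tests such events, and gives the almost sure
    convergence of V_c ([almost_supermartingale_cvg]).

    Identification of the limit.  As alpha is not summable, almost surely D(t) and
    F(x_i0(t)) - min F become small simultaneously at arbitrarily large times
    ([near_optimal_infinitely_often]).  On a single event of probability one, V_c
    converges for all minimizers c together, because V_c - |c|^2 is affine in c
    and finitely many minimizers span the others affinely ([affine_basis]).  Along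
    the good times x_i0 has a cluster point p; it is a minimizer, V_p converges,
    and V_p is arbitrarily small at good times, so V_p tends to 0 and all agents
    converge to p ([cvg_to_minimizer]). *)

(** * Integrable real functions *)
Section integrals.
Context {disp : measure_display} {T : measurableType disp} {R : realType}.
Variable P : probability T R.
Implicit Types (h k : T -> R) (A B : set T).

Definition intg h := P.-integrable [set: T] (EFin \o h).

Lemma intgS A h : measurable A -> intg h -> P.-integrable A (EFin \o h).
Proof. by move=> mA; apply: integrableS. Qed.

Lemma intg_meas h : intg h -> measurable_fun [set: T] h.
Proof. by move=> /measurable_int /measurable_EFinP. Qed.

Lemma intg_cst (c : R) : intg (cst c).
Proof.
by apply: finite_measure_integrable_cst.
Qed.

Lemma intgD h k : intg h -> intg k -> intg (fun w => h w + k w).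
Proof. by move=> ih ik; apply: (integrableD measurableT ih ik). Qed.

Lemma intgZ (c : R) h : intg h -> intg (fun w => c * h w).
Proof. by move=> ih; apply: (integrableZl measurableT c ih). Qed.

Lemma intgN h : intg h -> intg (fun w => - h w).
Proof. by move=> ih; apply: (integrableN ih). Qed.

Lemma intgB h k : intg h -> intg k -> intg (fun w => h w - k w).
Proof. by move=> ih ik; apply: intgD => //; apply: intgN. Qed.

Lemma intg_sum (I : Type) (s : seq I) (p : pred I) (h : I -> T -> R) :
  (forall i, p i -> intg (h i)) -> intg (fun w => \sum_(i <- s | p i) h i w).
Proof.
move=> ih; elim: s => [|i s IHs].
  by under eq_fun do rewrite big_nil; apply: intg_cst.
under eq_fun do rewrite big_cons; case: (boolP (p i)) => // pi.
by apply: intgD => //; exact: ih.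
Qed.

Lemma intg_le h k : measurable_fun [set: T] h -> intg k ->
  (forall w, `|h w| <= k w) -> intg h.
Proof.
move=> mh ik hk; apply: (le_integrable measurableT _ _ ik).
  exact/measurable_EFinP.
by move=> w _ /=; rewrite lee_fin (le_trans (hk w))// ler_norm.
Qed.

End integrals.

Lemma Rintegral_sum {disp : measure_display} {T : measurableType disp}
    {R : realType} (P : probability T R) (I : Type) (s : seq I) (h : I -> T -> R) A :
  measurable A -> (forall i, intg P (h i)) ->
  \int[P]_(w in A) (\sum_(i <- s) h i w) = \sum_(i <- s) \int[P]_(w in A) h i w.
Proof.
move=> mA ih; elim: s => [|i s IHs].
  by under eq_Rintegral do rewrite big_nil; rewrite big_nil Rintegral_cst ?mul0r.
under eq_Rintegral do rewrite big_cons.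
rewrite RintegralD// ?IHs ?big_cons//; first exact: intgS.
by apply: intgS => //; exact: intg_sum.
Qed.

Lemma Rintegral_le_setT {disp : measure_display} {T : measurableType disp}
    {R : realType} (P : probability T R) (h : T -> R) A :
  measurable A -> intg P h -> (forall w, 0 <= h w) ->
  \int[P]_(w in A) h w <= \int[P]_w h w.
Proof.
move=> mA ih h0; rewrite -[in leRHS](setUv A) Rintegral_setU//.
- by rewrite lerDl Rintegral_ge0.
- exact: measurableC.
- by rewrite setUv.
- by apply/disj_setPS => w [].
Qed.

(** * Convergence of almost supermartingales *)
Section almost_supermartingale.
Context {disp : measure_display} {T : measurableType disp} {R : realType}.
Variable P : probability T R.
Variables (H : nat -> set (set T)) (V : nat -> T -> R) (eps : nat -> R) (S : R).
Hypothesis H_meas : forall t, <<s H t >> `<=` measurable.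
Hypothesis H_mono : forall t, <<s H t >> `<=` <<s H t.+1 >>.
Hypothesis V_ge0 : forall t w, 0 <= V t w.
Hypothesis V_int : forall t, intg P (V t).
Hypothesis V_adapted : forall t,
  measurable_fun [set: g_sigma_algebraType (H t)] (V t : g_sigma_algebraType (H t) -> R).
Hypothesis V_super : forall t A, <<s H t >> A ->
  \int[P]_(w in A) V t.+1 w <= \int[P]_(w in A) V t w + eps t.
Hypothesis eps_sum : forall N, \sum_(t < N) eps t <= S.

Lemma measurable_of_adapted t A : <<s H t >> A -> measurable A.
Proof. exact: H_meas. Qed.

Lemma adapted_preimage t (B : set R) : measurable B -> <<s H t >> (V t @^-1` B).
Proof. by move=> mB; have := @V_adapted t measurableT _ mB; rewrite setTI. Qed.

(** The betting strategy of Doob's upcrossing argument: a share of V is bought when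
    V falls below [a] and kept until V exceeds [b]; [selling] marks the completion
    of an upcrossing of the interval from [a] to [b]. *)
Fixpoint holding (a b : R) (t : nat) : set T :=
  if t is t'.+1 then
    (holding a b t' `&` V t @^-1` `]-oo, b]) `|`
    (~` holding a b t' `&` V t @^-1` `]-oo, a[)
  else V 0 @^-1` `]-oo, a[.

Definition selling (a b : R) (t : nat) : set T :=
  holding a b t `&` V t.+1 @^-1` `]b, +oo[.

Lemma holding_adapted a b t : <<s H t >> (holding a b t).
Proof.
elim: t => [|t IHt] /=; first exact: adapted_preimage.
have IH := H_mono IHt.
apply: (@measurableU _ (g_sigma_algebraType (H t.+1)));
  apply: (@measurableI _ (g_sigma_algebraType (H t.+1))).
- exact: IH.
- exact: adapted_preimage.
- exact: (@measurableC _ (g_sigma_algebraType (H t.+1))).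
- exact: adapted_preimage.
Qed.

Lemma measurable_selling a b t : measurable (selling a b t).
Proof.
apply: measurableI; first exact: (measurable_of_adapted (@holding_adapted a b t)).
exact: (measurable_of_adapted (@adapted_preimage t.+1 _ (measurable_itv _))).
Qed.

(** A share held at time [t] gains at most [eps t] in mean up to time [t.+1],
    because the holding event belongs to the past.  At time [t.+1] the shares sold
    are worth at least [b - a] above [a], and those just bought are below [a]. *)
Lemma selling_step a b t :
  (b - a) * fine (P (selling a b t)) +
    \int[P]_(w in holding a b t.+1) (V t.+1 w - a) <=
  \int[P]_(w in holding a b t) (V t w - a) + eps t.
Proof.
set C := holding a b t; set U := selling a b t.
pose C' := C `&` V t.+1 @^-1` `]-oo, b].
pose Lo := ~` C `&` V t.+1 @^-1` `]-oo, a[.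
have mC : measurable C := measurable_of_adapted (@holding_adapted a b t).
have mpre B : measurable B -> measurable (V t.+1 @^-1` B).
  by move=> mB; exact: (measurable_of_adapted (@adapted_preimage _ _ mB)).
have mU : measurable U by exact: measurable_selling.
have mC' : measurable C' by apply: measurableI => //; exact: mpre.
have mLo : measurable Lo.
  by apply: measurableI; [exact: measurableC|exact: mpre].
have iY : intg P (fun w => V t.+1 w - a).
  by apply: intgB => //; exact: intg_cst.
(* [C] splits into what is sold and what is kept; the kept part and the new
   purchases [Lo] make up the next holding event *)
have CE : C = U `|` C'.
  rewrite /U /C' /selling -setIUr; apply/seteqP; split=> w /=; last by case.
  by move=> Cw; split=> //; rewrite !in_itv /= andbT; case: (leP (V t.+1 w) b);
    [right|left].
have -> : holding a b t.+1 = C' `|` Lo by [].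
have := V_super (@holding_adapted a b t); rewrite -/C => step.
have EC : \int[P]_(w in C) (V t.+1 w - a) =
    \int[P]_(w in U) (V t.+1 w - a) + \int[P]_(w in C') (V t.+1 w - a).
  rewrite {1}CE Rintegral_setU//; first by apply: intgS => //; exact: measurableU.
  apply/disj_setPS => w [[_ /=]]; rewrite in_itv/= andbT => bV [_ /=].
  by rewrite in_itv/= leNgt bV.
have EC' : \int[P]_(w in C' `|` Lo) (V t.+1 w - a) =
    \int[P]_(w in C') (V t.+1 w - a) + \int[P]_(w in Lo) (V t.+1 w - a).
  rewrite Rintegral_setU//; first by apply: intgS => //; exact: measurableU.
  by apply/disj_setPS => w [[Cw _] [NCw _]].
have int_cst A : measurable A -> P.-integrable A (EFin \o cst a).
  by move=> mA; apply: intgS => //; exact: intg_cst.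
have EV s : \int[P]_(w in C) (V s w - a) = \int[P]_(w in C) V s w - a * fine (P C).
  rewrite (@RintegralB _ _ _ P C (V s) (cst a))//.
  - by rewrite Rintegral_cst.
  - exact: intgS.
  - exact: int_cst.
have LU : (b - a) * fine (P U) <= \int[P]_(w in U) (V t.+1 w - a).
  rewrite -Rintegral_cst//; apply: le_Rintegral => //.
  - by apply: intgS => //; exact: (intg_cst P (b - a)).
  - exact: intgS.
  - by move=> w [_ /=]; rewrite in_itv/= andbT => bV; rewrite lerD2r ltW.
have LL : \int[P]_(w in Lo) (V t.+1 w - a) <= 0.
  have -> : 0 = \int[P]_(w in Lo) (0 : R) by rewrite Rintegral_cst// mul0r.
  apply: le_Rintegral => //.
  - exact: intgS.
  - by apply: intgS => //; exact: (intg_cst P 0).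
  - by move=> w [_ /=]; rewrite in_itv/= => Va; rewrite subr_le0 ltW.
rewrite EC' EV; move: EC; rewrite EV; lra.
Qed.

(** Telescoping [selling_step]; the share still held at the end is worth at least
    [- a] as V is nonnegative. *)
Lemma sum_selling_le a b N : 0 <= a ->
  (b - a) * (\sum_(t < N) fine (P (selling a b t))) <= a + S.
Proof.
move=> a0.
have mhold s := measurable_of_adapted (@holding_adapted a b s).
have start : \int[P]_(w in holding a b 0) (V 0 w - a) <= 0.
  have -> : 0 = \int[P]_(w in holding a b 0) (0 : R).
    by rewrite Rintegral_cst ?mul0r//; exact: mhold.
  apply: le_Rintegral; first exact: mhold.
  - apply: intgS; first exact: mhold.
    by apply: intgB => //; exact: intg_cst.
  - by apply: intgS; [exact: mhold|exact: (intg_cst P 0)].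
  - by move=> w /=; rewrite in_itv/= => Va; rewrite subr_le0 ltW.
have tele : (b - a) * (\sum_(t < N) fine (P (selling a b t))) +
    \int[P]_(w in holding a b N) (V N w - a) <= \sum_(t < N) eps t.
  elim: N => [|N IHN]; first by rewrite !big_ord0 mulr0 add0r.
  rewrite !big_ord_recr/= mulrDr; have := selling_step a b N.
  lra.
have low : - a <= \int[P]_(w in holding a b N) (V N w - a).
  have mC := mhold N.
  apply: (@le_trans _ _ (\int[P]_(w in holding a b N) (- a))); last first.
    apply: le_Rintegral => //.
    - by apply: intgS => //; exact: (intg_cst P (- a)).
    - by apply: intgS => //; apply: intgB => //; exact: intg_cst.
    - by move=> w _; rewrite lerDr.
  rewrite Rintegral_cst// mulNr lerN2 ler_piMr//.
  have := probability_le1 P mC; have := fin_num_measure P _ mC.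
  by move=> /fineK <-; rewrite lee_fin.
have := eps_sum N; lra.
Qed.

Lemma selling_finitely_often a b : 0 <= a -> a < b ->
  {ae P, forall w, exists N, forall t, (N <= t)%N -> ~ selling a b t w}.
Proof.
move=> a0 ab.
have null : P (lim_sup_set (selling a b)) = 0%E.
  apply: lim_sup_set_cvg0; first exact: measurable_selling.
  apply: (@le_lt_trans _ _ ((a + S) / (b - a))%:E); last exact: ltry.
  apply: lime_le; first by apply: is_cvg_nneseries => *; exact: measure_ge0.
  apply: nearW => N; rewrite big_mkord.
  rewrite (eq_bigr (fun t : 'I_N => (fine (P (selling a b t)))%:E)); last first.
    by move=> t _; rewrite fineK// fin_num_measure//; exact: measurable_selling.
  rewrite sumEFin lee_fin ler_pdivlMr ?subr_gt0// mulrC.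
  exact: sum_selling_le.
exists (lim_sup_set (selling a b)); split=> //.
- apply: bigcap_measurable => // k _; apply: bigcup_measurable => j _.
  exact: measurable_selling.
- move=> w /= Nfin n _.
  apply: contrapT => Nex; apply: Nfin; exists n => t nt sell.
  by apply: Nex; exists t.
Qed.

(** Once V has fallen below [a] after the last sale, the share is held forever,
    and it can only be held while V stays below [b]. *)
Lemma no_oscillation a b w : a < b ->
  (exists N, forall t, (N <= t)%N -> ~ selling a b t w) ->
  (forall N, exists2 t, (N <= t)%N & V t w < a) ->
  exists N, forall t, (N <= t)%N -> V t w <= b.
Proof.
move=> ab [N noU] often; have [t Nt Vta] := often N.
exists t; suff hold s : (t <= s)%N -> holding a b s w /\ V s w <= b.
  by move=> s ts; have [] := hold s ts.
elim: s => [|s IHs].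
  rewrite leqn0 => /eqP t0; move: Vta; rewrite t0 => Vta.
  by split=> /=; [rewrite in_itv/=|exact/ltW/(lt_trans Vta)].
rewrite leq_eqVlt => /orP[/eqP ts|]; last first.
  rewrite ltnS => ts; have [holds Vsb] := IHs ts.
  have Vb : V s.+1 w <= b.
    rewrite leNgt; apply/negP => bV; apply: (noU s (leq_trans Nt ts)).
    by split=> //=; rewrite in_itv/= andbT.
  by split=> //=; left; split=> //=; rewrite in_itv.
rewrite -ts; move: Vta; rewrite ts => Vta.
have Vb : V s.+1 w <= b by rewrite ltW// (lt_trans Vta).
split=> //=; have [hs|nhs] := pselect (holding a b s w).
  by left; split=> //=; rewrite in_itv.
by right; split=> //=; rewrite in_itv.
Qed.

Lemma mean_bound t : \int[P]_w V t w <= \int[P]_w V 0 w + S.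
Proof.
have : \int[P]_w V t w <= \int[P]_w V 0 w + \sum_(s < t) eps s.
  elim: t => [|t IHt]; first by rewrite big_ord0 addr0.
  rewrite big_ord_recr/=.
  have := V_super (@measurableT _ (g_sigma_algebraType (H t))); lra.
by have := eps_sum t; lra.
Qed.

(** Fatou's lemma: the means of V are bounded, so the lower limit of V is almost
    surely finite. *)
Lemma below_infinitely_often :
  {ae P, forall w, exists M : nat, forall N, exists2 t, (N <= t)%N & V t w < M%:R}.
Proof.
have mV t : measurable_fun [set: T] (EFin \o V t).
  by apply/measurable_EFinP; exact: intg_meas (V_int t).
have V0 t w : [set: T] w -> (0 <= (EFin \o V t) w)%E by move=> _; rewrite lee_fin.
have fat := fatou P measurableT mV V0.
have mlim : measurable_fun [set: T] (fun w => limn_einf (fun t => (V t w)%:E)).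
  apply: (measurableT_comp (@oppe_measurable R setT)); apply: measurable_fun_limn_esup => t.
  exact: (measurableT_comp (@oppe_measurable R setT) (mV t)).
have lim0 w : (0 <= limn_einf (fun t => (V t w)%:E))%E.
  rewrite limn_einf_lim; apply: lime_ge; first exact: is_cvg_einfs.
  by apply: nearW => N; apply: le_ereal_inf_tmp => _ [t _ <-]; rewrite lee_fin.
have fin : (\int[P]_w limn_einf (fun t => (V t w)%:E) < +oo)%E.
  apply: (le_lt_trans fat).
  apply: (@le_lt_trans _ _ (\int[P]_w V 0 w + S)%:E); last exact: ltry.
  rewrite limn_einf_lim; apply: lime_le; first exact: is_cvg_einfs.
  apply: nearW => N; apply: ge_ereal_inf; exists (\int[P]_w (EFin \o V N) w)%E;
    first by exists N => //=.
  have /fineK <- := integrable_fin_num measurableT (V_int N).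
  by rewrite lee_fin; exact: mean_bound.
have : P.-integrable [set: T] (fun w => limn_einf (fun t => (V t w)%:E)).
  apply/integrableP; split=> //.
  by under eq_integral => w _ do rewrite gee0_abs ?lim0//.
move=> /(integrable_ae measurableT); apply: filterS => w /(_ I) lfin.
set l := limn_einf _ in lfin; have := ltry (fine l); rewrite fineK// => _.
exists (Num.trunc (fine l)).+1 => N.
have : (einfs (fun t => (V t w)%:E) N < (Num.trunc (fine l)).+1%:R%:E)%E.
  apply: (@le_lt_trans _ _ l).
    rewrite /l limn_einf_lim; apply: lime_ge; first exact: is_cvg_einfs.
    by exists N => // m /= Nm; exact: nondecreasing_einfs.
  by rewrite -(fineK lfin) lte_fin truncnS_gt.
by move=> /ereal_inf_lt[_ [t /= Nt <-]]; rewrite lte_fin; exists t.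
Qed.

(** By [selling_finitely_often] applied to all rational intervals, V does not
    oscillate; the limit is the infimum of the rationals below which V falls
    infinitely often. *)
Theorem almost_supermartingale_cvg : {ae P, forall w, cvgn (fun t => V t w)}.
Proof.
(* an enumeration of the rational intervals; countably many null sets *)
pose q (k : nat) : rat * rat := odflt (0, 0) (unpickle k).
have osc : {ae P, forall w, forall k, 0 <= ratr (q k).1 :> R ->
    (q k).1 < (q k).2 ->
    exists N, forall t, (N <= t)%N -> ~ selling (ratr (q k).1) (ratr (q k).2) t w}.
  apply/ae_foralln => k.
  have [q0|] := boolP (0 <= ratr (q k).1 :> R); last first.
    by move=> _; apply: aeW.
  have [q12|] := boolP ((q k).1 < (q k).2); last first.
    by move=> _; apply: aeW.
  apply: filterS (@selling_finitely_often (ratr (q k).1) (ratr (q k).2) q0 _).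
    by move=> w.
  by rewrite ltr_rat.
apply: filterS2 osc below_infinitely_often => w osc [M often].
have {}osc (a b : rat) : 0 <= ratr a :> R -> a < b ->
    (forall N, exists2 t, (N <= t)%N & V t w < ratr a) ->
    exists N, forall t, (N <= t)%N -> V t w <= ratr b.
  move=> a0 ab; apply: no_oscillation; first by rewrite ltr_rat.
  by have := osc (pickle (a, b)); rewrite /q pickleK/=; exact.
pose A := [set x : R | exists2 a : rat, x = ratr a &
  forall N, exists2 t, (N <= t)%N & V t w < ratr a].
have A_ge0 x : A x -> 0 <= x.
  by move=> [a -> /(_ 0)[t _ /ltW]]; apply: le_trans.
have A_lb : has_lbound A by exists 0 => x /A_ge0.
have A0 : A !=set0 by exists M%:R, (M%:R) => //; rewrite ratr_nat.
have infA : has_inf A by split.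
apply/cvg_ex; exists (inf A); apply/cvgrPdist_le => e e0.
have [x Ax xe] := inf_adherent e0 infA.
case: Ax xe => a -> /[dup] Aa oftena ae.
have a0 : 0 <= ratr a :> R by apply: A_ge0; exists a.
have [b /itvP bae] := rat_in_itvoo ae.
have [c /itvP cae] : exists c : rat, ratr c \in `]inf A - e, inf A[.
  by apply: rat_in_itvoo; rewrite gtrDl oppr_lt0.
have [N1 VN1] : exists N, forall t, (N <= t)%N -> V t w <= ratr b.
  by apply: osc oftena => //; have := bae; rewrite -(ltr_rat R) => ->.
have [N2 VN2] : exists N, forall t, (N <= t)%N -> ratr c <= V t w.
  apply: contrapT => nN; have : A (ratr c).
    exists c => // N; apply: contrapT => nt; apply: nN; exists N => t Nt.
    by rewrite leNgt; apply/negP => Vc; apply: nt; exists t.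
  by move=> /(ge_inf A_lb); rewrite leNgt cae.
exists (maxn N1 N2) => // t /=; rewrite geq_max => /andP[/VN1 V1 /VN2 V2].
have := bae; have := cae.
rewrite ler_distlC => c1 b1; apply/andP; split.
  by apply: le_trans V2; rewrite ltW// c1.
by apply: (le_trans V1); rewrite ltW// b1.
Qed.

End almost_supermartingale.

(** * Square-integrable functions and orthogonality to the past *)
Section square_integrable.
Context {disp : measure_display} {T : measurableType disp} {R : realType}.
Variable P : probability T R.
Implicit Types (h k : T -> R).

Definition sqintg h := measurable_fun [set: T] h /\ intg P (fun w => h w ^+ 2).

Lemma sqintgM h k : sqintg h -> sqintg k -> intg P (fun w => h w * k w).
Proof.
move=> [mh ih] [mk ik]; apply: (intg_le (k := fun w => h w ^+ 2 + k w ^+ 2)).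
- exact: measurable_funM.
- exact: intgD.
- move=> w; rewrite normrM -(real_normK (num_real (h w))) -(real_normK (num_real (k w))).
  have := sqr_ge0 (`|h w| - `|k w|); have := normr_ge0 (h w); have := normr_ge0 (k w).
  nra.
Qed.

Lemma sqintgD h k : sqintg h -> sqintg k -> sqintg (fun w => h w + k w).
Proof.
move=> sh sk; split; first by apply: measurable_funD; [case: sh|case: sk].
under eq_fun do rewrite sqrrD.
apply: intgD; last by case: sk.
apply: intgD; first by case: sh.
under eq_fun do rewrite -mulr_natl.
by apply: intgZ; exact: sqintgM.
Qed.

Lemma sqintgZ (c : R) h : sqintg h -> sqintg (fun w => c * h w).
Proof.
move=> [mh ih]; split; first exact: measurable_funM.
by under eq_fun do rewrite exprMn; exact: intgZ.
Qed.

Lemma sqintg_cst (c : R) : sqintg (cst c).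
Proof. by split=> //; exact: (intg_cst P (c ^+ 2)). Qed.

Lemma sqintg_bounded (c : R) h : measurable_fun [set: T] h ->
  (forall w, `|h w| <= c) -> sqintg h.
Proof.
move=> mh hc; split=> //; apply: (intg_le (k := cst (c ^+ 2))).
- exact: measurable_funX.
- exact: intg_cst.
- move=> w /=; rewrite normrX ler_sqr ?nnegrE//.
  exact: le_trans (hc w).
Qed.

End square_integrable.

Section series_of_means.
Context {disp : measure_display} {T : measurableType disp} {R : realType}.
Variable P : probability T R.

(** By monotone convergence the sum of the series has a finite mean, hence is finite
    almost everywhere. *)
Lemma ae_bounded_series (h : nat -> T -> R) (S : R) :
  (forall t w, 0 <= h t w) -> (forall t, intg P (h t)) ->
  (forall N, \sum_(t < N) \int[P]_w h t w <= S) ->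
  {ae P, forall w, exists M, forall N, \sum_(t < N) h t w <= M}.
Proof.
move=> h0 ih hS.
have mh t : measurable_fun [set: T] (EFin \o h t).
  by apply/measurable_EFinP; exact: intg_meas (ih t).
have h0' t w : [set: T] w -> (0 <= (EFin \o h t) w)%E by rewrite lee_fin.
have E := integral_nneseries P measurableT mh h0'.
have fin : (\int[P]_w (\sum_(t <oo) (h t w)%:E) < +oo)%E.
  rewrite E; apply: (@le_lt_trans _ _ S%:E); last exact: ltry.
  apply: lime_le.
    by apply: is_cvg_nneseries => t _ _; apply: integral_ge0 => w; exact: h0'.
  apply: nearW => N; rewrite big_mkord.
  rewrite [leLHS](eq_bigr (fun t : 'I_N => (\int[P]_w h t w)%:E)); last first.
    by move=> t _; rewrite fineK//; exact: integrable_fin_num (ih t).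
  by rewrite sumEFin lee_fin; exact: hS.
have ge0 w : (0 <= \sum_(t <oo) (h t w)%:E)%E.
  by apply: nneseries_ge0 => t _ _; rewrite lee_fin.
have : P.-integrable [set: T] (fun w => \sum_(t <oo) (h t w)%:E)%E.
  apply/integrableP; split.
    apply: (@ge0_emeasurable_sum _ _ _ _ (fun t w => (h t w)%:E) xpredT) => [t w _ _|t
      _]; [by rewrite lee_fin|exact: mh].
  by under eq_integral => w _ do rewrite gee0_abs ?ge0//.
move=> /(integrable_ae measurableT); apply: filterS => w /(_ I) lfin.
exists (fine (\sum_(t <oo) (h t w)%:E)%E) => N.
rewrite -lee_fin fineK// -sumEFin -(big_mkord xpredT (fun t => (h t w)%:E)).
by apply: nneseries_lim_ge => t _; rewrite lee_fin.
Qed.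

End series_of_means.

Section orthogonality.
Import HBSimple.
Import HBNNSimple.
Context {disp : measure_display} {T : measurableType disp} {R : realType}.
Variable P : probability T R.
Variable H : set (set T).
Hypothesis H_meas : forall A, <<s H >> A -> measurable A.
Variable Z : T -> R.
Hypothesis Z_int : intg P Z.
Hypothesis Z_centred : forall A, <<s H >> A -> \int[P]_(w in A) Z w = 0.

Local Notation TH := (g_sigma_algebraType H).

Lemma measurable_of_sub (h : T -> R) :
  measurable_fun [set: TH] (h : TH -> R) -> measurable_fun [set: T] h.
Proof.
move=> mh _ B mB; rewrite setTI; apply: H_meas.
by have := mh (@measurableT _ TH) _ mB; rewrite setTI.
Qed.

(** The case of indicators is the hypothesis [Z_centred]; simple functions follow
    by linearity and [h] by dominated convergence, the approximations from below
    being dominated by [h]. *)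
Lemma centred_mul_ge0 (h : T -> R) A :
  (forall w, 0 <= h w) -> measurable_fun [set: TH] (h : TH -> R) ->
  intg P (fun w => Z w * h w) -> <<s H >> A ->
  \int[P]_(w in A) (Z w * h w) = 0.
Proof.
move=> h0 mh iZh HA; have mA := H_meas HA.
have mEh : measurable_fun [set: TH] (EFin \o (h : TH -> R)).
  exact/measurable_EFinP.
pose g := nnsfun_approx (@measurableT _ TH) mEh.
have g_cvg (w : TH) : (fun n => (g n w)%:E) @ \oo --> (h w)%:E.
  by apply: (cvg_nnsfun_approx (@measurableT _ TH) mEh) => // x _; rewrite lee_fin.
have g_nd m n (w : TH) : (m <= n)%N -> g m w <= g n w.
  by move=> mn; have /lefP := nd_nnsfun_approx (@measurableT _ TH) mEh mn; exact.
have g_cvgR (w : TH) : (fun n => g n w) @ \oo --> h w.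
  by have /fine_cvgP[_] := g_cvg w.
have g_le n (w : TH) : g n w <= h w.
  rewrite -(cvg_lim _ (g_cvgR w))//; apply: nondecreasing_cvgn_le.
    by move=> m k mk; exact: g_nd.
  by apply/cvg_ex; exists (h w).
have mg n : measurable_fun [set: T] (g n : T -> R).
  by apply: measurable_of_sub; exact: measurable_funPT.
have mZ := intg_meas Z_int.
have gE n : \int[P]_(w in A) (Z w * g n w) = 0.
  have mB y : measurable ((g n : T -> R) @^-1` [set y]).
    by have := mg n measurableT _ (measurable_set1 y); rewrite setTI.
  have HB y : <<s H >> ((g n : T -> R) @^-1` [set y]).
    exact: (measurable_funPTI (g n) (measurable_set1 y)).
  have iZB y : intg P (fun w => Z w * \1_((g n : T -> R) @^-1` [set y]) w).
    apply: (intg_le (k := fun w => `|Z w|)).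
    - by apply: measurable_funM => //; exact: measurable_indic.
    - exact: (integrable_abse Z_int).
    - move=> w; rewrite normrM ler_piMr// indicE.
      by case: (_ \in _); rewrite ?normr1 ?normr0.
  rewrite (@eq_Rintegral _ _ _ _ _ (fun w => \sum_(y <- finmap.enum_fset (fset_set (range
    (g n))))
      (y * (Z w * \1_((g n : T -> R) @^-1` [set y]) w)))); last first.
    move=> w _; rewrite fimfunE fsbig_finite//= big_distrr/=.
    by apply: eq_bigr => y _; rewrite mulrCA.
  rewrite Rintegral_sum//; last by move=> y; apply: intgZ.
  apply: big1 => y _.
  rewrite RintegralZl//; last exact: intgS.
  rewrite (_ : \int[P]_(w in A) _ = 0) ?mulr0//.
  rewrite -(Z_centred (A := A `&` (g n : T -> R) @^-1` [set y])).
    rewrite Rintegral_mkcondr; apply: eq_Rintegral => w _.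
    by rewrite patchE indicE; case: ifP => _; rewrite ?mulr1 ?mulr0.
  exact: (@measurableI _ TH).
have [] := dominated_convergence (mu := P) mA
  (f_ := fun n w => (Z w * g n w)%:E) (f := fun w => (Z w * h w)%:E)
  (g := fun w => `|Z w * h w|%:E).
- move=> n; apply: measurable_funTS; apply/measurable_EFinP.
  exact: measurable_funM.
- by apply: measurable_funTS; apply/measurable_EFinP; exact: intg_meas iZh.
- apply: aeW => w _; apply: cvg_EFin.
    by apply: nearW.
  by apply: cvgM; [exact: cvg_cst|exact: g_cvgR].
- by apply: intgS => //; exact: (integrable_abse iZh).
- apply: aeW => w n _; rewrite lee_fin !normrM ler_wpM2l//.
  by rewrite ger0_norm// ger0_norm.
move=> _ _; rewrite -[X in _ --> X](@fineK _ _ (integrable_fin_num mA (intgS mA iZh))).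
move=> /fine_cvgP[_] /=.
rewrite [X in X @ _ --> _](_ : _ = cst 0); last by apply/funext => n; exact: gE.
by rewrite /Rintegral => /cvg_lim <-//; rewrite lim_cst.
Qed.

Lemma centred_mul (h : T -> R) A :
  measurable_fun [set: TH] (h : TH -> R) ->
  intg P (fun w => Z w * h w) -> <<s H >> A ->
  \int[P]_(w in A) (Z w * h w) = 0.
Proof.
move=> mh iZh HA; have mA := H_meas HA.
have mhT := measurable_of_sub mh.
have mZ := intg_meas Z_int.
pose hp w := Num.max (h w) 0; pose hn w := Num.max (- h w) 0.
have mhp : measurable_fun [set: TH] (hp : TH -> R).
  exact: measurable_maxr.
have mhn : measurable_fun [set: TH] (hn : TH -> R).
  by apply: measurable_maxr => //; exact: measurableT_comp.
have hE w : h w = hp w - hn w.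
  by rewrite /hp /hn /Num.max; have [?|?] := ltP (h w) 0; have [?|?] := ltP (- h w) 0; lra.
have ip : intg P (fun w => Z w * hp w).
  apply: (intg_le (k := fun w => `|Z w * h w|)).
  - by apply: measurable_funM => //; exact: measurable_of_sub.
  - exact: (integrable_abse iZh).
  - move=> w; rewrite !normrM ler_wpM2l// /hp /Num.max.
    by case: ltP => // _; rewrite normr0.
have in_ : intg P (fun w => Z w * hn w).
  apply: (intg_le (k := fun w => `|Z w * h w|)).
  - by apply: measurable_funM => //; exact: measurable_of_sub.
  - exact: (integrable_abse iZh).
  - move=> w; rewrite !normrM ler_wpM2l// /hn /Num.max.
    by case: ltP => // _; rewrite ?normr0 ?normrN.
under eq_Rintegral do rewrite hE mulrBr.
rewrite RintegralB//; [|exact: intgS|exact: intgS].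
by rewrite !centred_mul_ge0 ?subrr// => w; rewrite le_max lexx orbT.
Qed.

End orthogonality.

(** * Step-size series *)
Section power_series.
Context {R : realType}.
Implicit Types (p s a : R).

(** The discrete form of integrating the power function: it makes the p-series
    telescope.  It comes from [1 + u <= expR u] and [ln (1 - v) <= - v] with
    [v = 1 / t.+1]. *)
Lemma powR_decrement_ge s (t : nat) : 0 < s -> (0 < t)%N ->
  s / (t.+1%:R `^ (1 + s)) <= (t%:R `^ s)^-1 - (t.+1%:R `^ s)^-1.
Proof.
move=> s0 t0; have tR : 0 < t%:R :> R by rewrite ltr0n.
have tR1 : 0 < t.+1%:R :> R by rewrite ltr0n.
have a0 : 0 < t%:R `^ s :> R by exact: powR_gt0.
have b0 : 0 < t.+1%:R `^ s :> R by exact: powR_gt0.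
have key : 1 + s / t.+1%:R <= (t.+1%:R `^ s) / (t%:R `^ s).
  have -> : t.+1%:R `^ s / t%:R `^ s = expR (s * (- ln (t%:R / t.+1%:R))) :> R.
    rewrite /powR !gt_eqF// -expRN -expRD ln_div ?posrE//.
    by congr expR; rewrite opprB mulrBr.
  apply: (le_trans _ (expR_ge1Dx _)); rewrite lerD2l (ler_wpM2l (ltW s0))//.
  have -> : t%:R / t.+1%:R = 1 + (- t.+1%:R^-1) :> R.
    have -> : t%:R = t.+1%:R - 1 :> R by rewrite -natr1 addrK.
    by rewrite mulrBl mulfV ?gt_eqF// mul1r.
  rewrite lerNr; apply: le_ln1Dx.
  by rewrite ltrN2 invf_lt1// ltr1n ltnS.
have -> : t.+1%:R `^ (1 + s) = t.+1%:R * t.+1%:R `^ s :> R.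
  by rewrite powRD ?powRr1 ?ltW//; apply/implyP => _; rewrite gt_eqF.
rewrite invfM mulrA lerBrDr -(ler_pM2r b0) mulrDl mulVf ?gt_eqF// mulfVK ?gt_eqF//.
by rewrite addrC [leRHS]mulrC.
Qed.

Lemma sum_inv_powR_le p : 1 < p ->
  exists S : R, forall N, \sum_(1 <= t < N) (t%:R `^ p)^-1 <= S.
Proof.
move=> p1; pose s := p - 1; have s0 : 0 < s by rewrite subr_gt0.
have pE : p = 1 + s by rewrite /s addrC subrK.
exists (1 + s^-1) => -[|[|N]].
- by rewrite big_geq// ltW// ltr_wpDl// invr_gt0.
- by rewrite big_geq// ltW// ltr_wpDl// invr_gt0.
suff : \sum_(1 <= t < N.+2) (t%:R `^ p)^-1 <= 1 + s^-1 * (1 - (N.+1%:R `^ s)^-1).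
  move=> /le_trans; apply; rewrite lerD2l ler_piMr ?invr_ge0 ?(ltW s0)//.
elim: N => [|N IHN]; first by rewrite big_nat1 !powR1 invr1 subrr mulr0 addr0.
rewrite big_nat_recr//=; have := @powR_decrement_ge s N.+1 s0 isT.
rewrite -pE => dec; move: IHN; set A := \sum_(1 <= t < _) _.
have : (N.+2%:R `^ p)^-1 <= s^-1 * ((N.+1%:R `^ s)^-1 - (N.+2%:R `^ s)^-1).
  by rewrite ler_pdivlMl.
set u := (N.+1%:R `^ s)^-1; set v := (N.+2%:R `^ s)^-1; set w := (N.+2%:R `^ p)^-1.
by rewrite !mulrBr; lra.
Qed.

Lemma sum_inv_powR_unbounded p c M (N0 : nat) : 0 <= p <= 1 -> 0 < c ->
  exists N, M < \sum_(N0 <= t < N) (c / t%:R `^ p).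
Proof.
move=> p01 c0; apply: contrapT => bnd; apply: (@dvg_riemannR R p p01).
have {}bnd N : \sum_(N0 <= t < N) (t%:R `^ p)^-1 <= M / c.
  rewrite ler_pdivlMr// mulrC big_distrr/=.
  by rewrite leNgt; apply/negP => MN; apply: bnd; exists N.
apply: nondecreasing_is_cvgn.
  apply: nondecreasing_series => t _ _; exact/ltW/riemannR_gt0/(andP p01).1.
exists (\sum_(0 <= t < N0) riemannR p t + M / c) => _ [N _ <-].
rewrite /series /=; apply: (@le_trans _ _ (\sum_(0 <= t < N0 + N) riemannR p t)).
  rewrite addnC (@big_cat_nat _ _ _ N 0 (N + N0)) ?leq_addr//= lerDl sumr_ge0// => t _.
  exact/ltW/riemannR_gt0/(andP p01).1.
rewrite (@big_cat_nat _ _ _ N0) ?leq_addr//= lerD2l.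
apply: le_trans (bnd (N0 + N).+1).
case: N => [|N].
  by rewrite addn0 big_geq// sumr_ge0// => t _; rewrite invr_ge0 powR_ge0.
rewrite [leRHS]big_ltn ?ltnS ?leq_addr//= big_add1/=.
rewrite lerDr invr_ge0; exact: powR_ge0.
Qed.

End power_series.

Section window_sums.
Context {R : realType}.

Lemma ler_sum_nat_widen (u : nat -> R) m n m' n' :
  (m' <= m)%N -> (n <= n')%N -> (forall s, (m' <= s)%N -> 0 <= u s) ->
  \sum_(m <= s < n) u s <= \sum_(m' <= s < n') u s.
Proof.
move=> mm' nn' u0; have [nm|mn] := leqP n m.
  rewrite big_geq// big_nat_cond sumr_ge0// => s /andP[/andP[ms _] _]; exact: u0.
rewrite (@big_cat_nat _ _ _ m m' n')//=; last by rewrite (leq_trans (ltnW mn)).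
rewrite (@big_cat_nat _ _ _ n m n')//=; last exact: ltnW.
rewrite addrCA lerDl addr_ge0// big_nat_cond sumr_ge0// => s /andP[/andP[ns _] _].
  exact: u0.
by apply: u0; rewrite (leq_trans mm')// (leq_trans (ltnW mn)).
Qed.

Lemma sum_ord_shift (u : nat -> R) (T0 N : nat) :
  \sum_(t < N) u (t + T0)%N = \sum_(T0 <= t < N + T0) u t.
Proof.
rewrite -(big_mkord xpredT (fun t => u (t + T0)%N)).
by rewrite -[in RHS](add0n T0) big_addn addnK.
Qed.

Lemma sum_window_le (u : nat -> R) (T0 B N : nat) :
  (B < T0)%N -> (forall s, (0 < s)%N -> 0 <= u s) ->
  \sum_(T0 <= t < N) \sum_(k < B) u (t - k.+1)%N <=
  B%:R * \sum_(1 <= s < N) u s.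
Proof.
move=> BT u0; rewrite exchange_big/= mulr_natl -[in leRHS](card_ord B) -sumr_const.
apply: ler_sum => k _.
have kT : (k < T0)%N by apply: leq_trans (ltn_ord k) (ltnW BT).
have -> : \sum_(T0 <= t < N) u (t - k.+1)%N = \sum_(T0 - k.+1 <= s < N - k.+1) u s.
  rewrite -[in LHS](subnK kT) (@big_addn _ _ _ (T0 - k.+1)%N N k.+1).
  by apply: eq_bigr => s _; rewrite addnK.
apply: ler_sum_nat_widen => //; last exact: leq_subr.
by rewrite subn_gt0 (leq_ltn_trans _ BT)// ltn_ord.
Qed.

(** The means of the one-step inequality form a recursion in which [d], the mean
    consensus error, is only controlled by the dissipations [Q] of the [B] previous
    steps.  Summing over time, each [Q s] is charged at most [B] times, hence at
    most [1 / 4] of it in total by the smallness of [delta], while the recursion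
    provides [3 / 8] of it. *)
Lemma absorb_windows (v Q p b d : nat -> R) (T0 B : nat) (K delta S : R) :
  (B < T0)%N -> 0 <= K -> 0 <= delta -> delta * K * B%:R <= 1 / 4 ->
  (forall t, 0 <= v t) -> (forall t, (0 < t)%N -> 0 <= Q t) ->
  (forall t, (0 < t)%N -> 0 <= p t) ->
  (forall t, (0 < t)%N -> 0 <= b t) ->
  (forall N, \sum_(1 <= t < N) b t <= S) ->
  (forall t, (T0 <= t)%N -> v t.+1 + 3 / 8 * Q t + p t <= v t + delta * d t + b t) ->
  (forall t, (T0 <= t)%N ->
    d t <= K * \sum_(k < B) (Q (t - k.+1)%N + b (t - k.+1)%N)) ->
  exists M, forall N,
    \sum_(T0 <= t < N) p t <= M /\ \sum_(T0 <= t < N) d t <= M.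
Proof.
move=> BT K0 del0 small v0 Q0 p0 b0 bS step win.
have T0gt0 : (0 < T0)%N by exact: leq_ltn_trans BT.
have S0 : 0 <= S by have := bS 0; rewrite big_geq.
pose q0 := \sum_(1 <= t < T0) Q t.
have q00 : 0 <= q0.
  by rewrite /q0 big_nat_cond sumr_ge0// => s /andP[/andP[ms _] _]; exact: Q0.
have dle N : \sum_(T0 <= t < N) d t <=
    K * B%:R * (\sum_(1 <= t < N) Q t + \sum_(1 <= t < N) b t).
  apply: (@le_trans _ _ (\sum_(T0 <= t < N) (K * \sum_(k < B) (Q (t - k.+1)%N + b (t -
    k.+1)%N)))).
    rewrite big_nat_cond [leRHS]big_nat_cond; apply: ler_sum => t /andP[/andP[Tt _] _].
    exact: win.
  rewrite -big_distrr/= -mulrA ler_wpM2l// -big_split/=.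
  apply: (sum_window_le (u := fun s => Q s + b s)) => // s s0.
  by rewrite addr_ge0 ?Q0 ?b0.
have qle N : \sum_(1 <= t < N) Q t <= q0 + \sum_(T0 <= t < N) Q t.
  have [NT|TN] := leqP N T0.
    rewrite [X in _ + X]big_geq// addr0 /q0.
    exact: ler_sum_nat_widen.
  by rewrite (@big_cat_nat _ _ _ T0 1 N)//= ltnW.
have tele N : (T0 <= N)%N -> v N + 3 / 8 * (\sum_(T0 <= t < N) Q t) + \sum_(T0 <= t < N) p t
    <= v T0 + delta * (\sum_(T0 <= t < N) d t) + \sum_(T0 <= t < N) b t.
  elim: N => [|N IHN]; first by rewrite leqn0 => /eqP T00; rewrite T00 in T0gt0.
  rewrite leq_eqVlt => /orP[/eqP <-|].
    by rewrite !big_geq// !mulr0 !addr0.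
  rewrite ltnS => TN; have := step N TN; have := IHN TN.
  rewrite !(big_nat_recr N)//=; set a1 := \sum_(_ <= _ < _) _.
  set a2 := \sum_(_ <= _ < _) _; set a3 := \sum_(_ <= _ < _) _; set a4 := \sum_(_ <= _ < _) _.
  by rewrite !mulrDr; lra.
have bT N : \sum_(T0 <= t < N) b t <= S.
  by apply: le_trans (bS N); exact: ler_sum_nat_widen.
have Qbound N : \sum_(T0 <= t < N) Q t <= 8 * (v T0 + q0 / 4 + S / 4 + S) /\
    \sum_(T0 <= t < N) p t <= v T0 + q0 / 4 + S / 4 + S.
  have [NT|TN] := leqP N T0.
    by rewrite !big_geq//; have := v0 T0; split; lra.
  have := tele N (ltnW TN); have := bT N; have := dle N; have := qle N; have := bS N.
  set b1 := \sum_(1 <= _ < _) _; set q1 := \sum_(1 <= _ < _) _.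
  set q2 := \sum_(T0 <= _ < _) Q _; set d2 := \sum_(T0 <= _ < _) d _.
  set b2 := \sum_(T0 <= _ < _) b _; set p2 := \sum_(T0 <= _ < _) p _.
  move=> b1S q1le d2le b2S te.
  have q10 : 0 <= q1 + b1.
    rewrite addr_ge0// /q1 /b1 big_nat_cond sumr_ge0// => s /andP[/andP[ms _] _].
      exact: Q0.
    exact: b0.
  have p20 : 0 <= p2.
    rewrite /p2 big_nat_cond sumr_ge0// => s /andP[/andP[ms _] _].
    by apply: p0; exact: leq_trans ms.
  have q20 : 0 <= q2.
    rewrite /q2 big_nat_cond sumr_ge0// => s /andP[/andP[ms _] _].
    by apply: Q0; exact: leq_trans ms.
  have dd : delta * d2 <= 1 / 4 * (q1 + b1).
    apply: (@le_trans _ _ (delta * (K * B%:R * (q1 + b1)))).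
      by rewrite ler_wpM2l// mulr_ge0.
    by rewrite !mulrA ler_wpM2r.
  have := v0 N; have := v0 T0; split; lra.
exists (Num.max (v T0 + q0 / 4 + S / 4 + S)
  (K * B%:R * (q0 + 8 * (v T0 + q0 / 4 + S / 4 + S) + S))) => N.
have [Qb pb] := Qbound N; split; first by rewrite le_max pb.
rewrite le_max; apply/orP; right; apply: (le_trans (dle N)).
rewrite ler_wpM2l ?mulr_ge0// lerD//.
by apply: (le_trans (qle N)); rewrite lerD2l.
Qed.

End window_sums.

(** * Euclidean geometry *)
Section euclidean.
Context {R : realType} {d : nat}.
Implicit Types (u v w c : 'rV[R]_d) (a b : R).

Definition sq u : R := dotv u u.

Lemma dotvC u v : dotv u v = dotv v u.
Proof. by apply: eq_bigr => k _; rewrite mulrC. Qed.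

Lemma dotvDl u v w : dotv (u + v) w = dotv u w + dotv v w.
Proof. by rewrite /dotv -big_split; apply: eq_bigr => k _; rewrite mxE mulrDl. Qed.

Lemma dotvZl a u v : dotv (a *: u) v = a * dotv u v.
Proof. by rewrite /dotv big_distrr/=; apply: eq_bigr => k _; rewrite mxE mulrA. Qed.

Lemma dotvDr u v w : dotv w (u + v) = dotv w u + dotv w v.
Proof. by rewrite dotvC dotvDl !(dotvC w). Qed.

Lemma dotvZr a u v : dotv u (a *: v) = a * dotv u v.
Proof. by rewrite dotvC dotvZl dotvC. Qed.

Lemma dotvNl u v : dotv (- u) v = - dotv u v.
Proof. by rewrite -scaleN1r dotvZl mulN1r. Qed.

Lemma dotvNr u v : dotv u (- v) = - dotv u v.
Proof. by rewrite -scaleN1r dotvZr mulN1r. Qed.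

Lemma dotv_sumr (I : Type) (s : seq I) (F : I -> 'rV[R]_d) u :
  dotv u (\sum_(i <- s) F i) = \sum_(i <- s) dotv u (F i).
Proof.
elim: s => [|i s IHs]; last by rewrite !big_cons dotvDr IHs.
by rewrite !big_nil -(scale0r u) dotvZr mul0r.
Qed.

Lemma sq_ge0 u : 0 <= sq u.
Proof. by apply: sumr_ge0 => k _; rewrite -expr2 sqr_ge0. Qed.

Lemma sqD u v : sq (u + v) = sq u + 2 * dotv u v + sq v.
Proof. by rewrite /sq dotvDl !dotvDr (dotvC v u); ring. Qed.

Lemma sqZ a u : sq (a *: u) = a ^+ 2 * sq u.
Proof. by rewrite /sq dotvZl dotvZr mulrA. Qed.

Lemma sqN u : sq (- u) = sq u.
Proof. by rewrite -scaleN1r sqZ sqrrN expr1n mul1r. Qed.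

Lemma sqB u v : sq (u - v) = sq u - 2 * dotv u v + sq v.
Proof. by rewrite sqD sqN dotvNr; ring. Qed.

Lemma sq_distC u v : sq (u - v) = sq (v - u).
Proof. by rewrite -opprB sqN. Qed.

Lemma sqD_le u v : sq (u + v) <= 2 * sq u + 2 * sq v.
Proof. by rewrite sqD; have := sq_ge0 (u - v); rewrite sqB; lra. Qed.

Lemma enorm_ge0 u : 0 <= enorm u.
Proof. exact: sqrtr_ge0. Qed.

Lemma enorm_sqr u : enorm u ^+ 2 = sq u.
Proof. by rewrite sqr_sqrtr// sq_ge0. Qed.

Lemma young_dotv lam u v : 0 < lam -> 2 * dotv u v <= lam * sq u + sq v / lam.
Proof.
move=> l0; rewrite -(ler_pM2l l0) mulrDr.
have -> : lam * (sq v / lam) = sq v by rewrite mulrC divfK// gt_eqF.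
by have := sq_ge0 (lam *: u - v); rewrite sqB sqZ dotvZl; lra.
Qed.

Lemma cauchy_schwarz_dotv u v : dotv u v <= enorm u * enorm v.
Proof.
have [u0|u0] := eqVneq (enorm u) 0.
  have su : sq u = 0 by rewrite -enorm_sqr u0 expr0n.
  rewrite u0 mul0r leNgt; apply/negP => uv0.
  have lam0 : 0 < sq v / dotv u v + 1.
    by rewrite ltr_wpDl// mulr_ge0 ?sq_ge0// invr_ge0 ltW.
  have := young_dotv u v lam0; rewrite su mulr0 add0r ler_pdivlMr//.
  have -> : 2 * dotv u v * (sq v / dotv u v + 1) = 2 * sq v + 2 * dotv u v.
    by field; rewrite gt_eqF.
  by have := sq_ge0 v; lra.
have up : 0 < enorm u by rewrite lt_neqAle eq_sym u0 enorm_ge0.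
have [v0|v0] := eqVneq (enorm v) 0.
  have sv : sq v = 0 by rewrite -enorm_sqr v0 expr0n.
  rewrite v0 mulr0 leNgt; apply/negP => uv0.
  have su : 0 < sq u by rewrite -enorm_sqr exprn_gt0.
  have lam : 0 < dotv u v / sq u by rewrite divr_gt0.
  have := young_dotv u v lam; rewrite sv mul0r addr0 divfK ?gt_eqF//; lra.
have vp : 0 < enorm v by rewrite lt_neqAle eq_sym v0 enorm_ge0.
have lam : 0 < enorm v / enorm u by rewrite divr_gt0.
have := young_dotv u v lam; rewrite -!enorm_sqr.
have -> : enorm v / enorm u * enorm u ^+ 2 + enorm v ^+ 2 / (enorm v / enorm u)
  = 2 * (enorm u * enorm v) by field; rewrite u0 v0.
by rewrite ler_pM2l.
Qed.

Lemma enormD u v : enorm (u + v) <= enorm u + enorm v.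
Proof.
rewrite -ler_sqr ?nnegrE ?addr_ge0 ?enorm_ge0// enorm_sqr sqD sqrrD !enorm_sqr.
by have := cauchy_schwarz_dotv u v; rewrite -mulr_natl; lra.
Qed.

Lemma enormN u : enorm (- u) = enorm u.
Proof. by rewrite /enorm -/(sq _) sqN. Qed.

Lemma enorm_distC u v : enorm (u - v) = enorm (v - u).
Proof. by rewrite -opprB enormN. Qed.

Lemma enorm_le_sqrt u a : sq u <= a -> enorm u <= Num.sqrt a.
Proof. exact: ler_wsqrtr. Qed.

Lemma enorm_triangle w u v : enorm (u - v) <= enorm (u - w) + enorm (w - v).
Proof. by apply: le_trans (enormD _ _); rewrite addrA subrK. Qed.

Lemma variance_identity (I : finType) (p : I -> R) (z : I -> 'rV[R]_d) c :
  \sum_i p i = 1 -> let m := \sum_i p i *: z i in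
  \sum_i p i * sq (z i - c) = sq (m - c) + \sum_i p i * sq (z i - m).
Proof.
move=> p1 m.
have zE i : sq (z i - c) = sq (z i - m) + 2 * dotv (m - c) (z i - m) + sq (m - c).
  have -> : z i - c = (z i - m) + (m - c) by rewrite addrA subrK.
  by rewrite sqD (dotvC (m - c)).
under eq_bigr do rewrite zE 2!mulrDr.
rewrite !big_split/= -big_distrl/= p1 mul1r.
have -> : \sum_i p i * (2 * dotv (m - c) (z i - m)) = 0.
  rewrite (eq_bigr (fun i => 2 * dotv (m - c) (p i *: (z i - m)))); last first.
    by move=> i _; rewrite dotvZr mulrCA.
  rewrite -big_distrr/= -dotv_sumr.
  under [X in dotv _ X]eq_bigr do rewrite scalerBr.
  by rewrite sumrB -/m -scaler_suml p1 scale1r subrr -(scale0r c) dotvZr mul0r mulr0.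
by rewrite addr0 addrC.
Qed.

Lemma sq_mean_le (I : finType) (p : I -> R) (z : I -> 'rV[R]_d) :
  (forall i, 0 <= p i) -> \sum_i p i = 1 ->
  sq (\sum_i p i *: z i) <= \sum_i p i * sq (z i).
Proof.
move=> p0 p1; have /= := variance_identity z 0 p1.
under eq_bigr do rewrite subr0; rewrite subr0 => ->.
by rewrite lerDl sumr_ge0// => i _; rewrite mulr_ge0 ?sq_ge0.
Qed.

End euclidean.

(** * One step of the dynamics *)
Section one_step.
Context {R : realType} {n d : nat}.
Variables (r : 'cV[R]_n) (W : 'M[R]_n) (L : R).
Hypothesis r_gt0 : forall i, 0 < r i 0.
Hypothesis r_sum1 : \sum_i r i 0 = 1.
Hypothesis W_ge0 : forall i j, 0 <= W i j.
Hypothesis W_row : forall i, \sum_j W i j = 1.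
Hypothesis W_col : forall j, \sum_i r i 0 * W i j = r j 0.
Implicit Types (x e g : 'I_n -> 'rV[R]_d) (c : 'rV[R]_d) (a b delta : R).

Definition wdist x c : R := \sum_i r i 0 * sq (x i - c).
Definition wnorm e : R := \sum_i r i 0 * sq (e i).
Definition disagreement x : R := \sum_i r i 0 * \sum_j W i j * sq (x i - x j).
Definition mixed b x i : 'rV[R]_d := (1 - b) *: x i + b *: \sum_j W i j *: x j.
Definition stepped a b x e g i : 'rV[R]_d := mixed b x i + b *: e i - a *: g i.

Lemma r_ge0 i : 0 <= r i 0. Proof. exact: ltW. Qed.

Lemma wdist_ge0 x c : 0 <= wdist x c.
Proof. by apply: sumr_ge0 => i _; rewrite mulr_ge0 ?sq_ge0 ?r_ge0. Qed.

Lemma wnorm_ge0 e : 0 <= wnorm e.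
Proof. by apply: sumr_ge0 => i _; rewrite mulr_ge0 ?sq_ge0 ?r_ge0. Qed.

Lemma disagreement_ge0 x : 0 <= disagreement x.
Proof.
apply: sumr_ge0 => i _; rewrite mulr_ge0 ?r_ge0// sumr_ge0// => j _.
by rewrite mulr_ge0 ?sq_ge0.
Qed.

(** The squared distance of a mean [y] to [c] falls short of the mean of the squared
    distances by the variance of the family around [y].  As the weight [1 - b] of
    [x i] is at least [b], that variance controls the squared distances of [x i] to
    the other points, by the triangle inequality through [y]. *)
Lemma mixed_dissipation b x c i : 0 <= b -> b <= 1 / 2 ->
  sq (mixed b x i - c) + b / 2 * \sum_j W i j * sq (x i - x j) <=
  (1 - b) * sq (x i - c) + b * \sum_j W i j * sq (x j - c).
Proof.
move=> b0 b2; set y := mixed b x i; set m := \sum_j W i j *: x j.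
have varc : \sum_j W i j * sq (x j - c) =
    sq (m - c) + \sum_j W i j * sq (x j - m) by exact: variance_identity.
have vary : \sum_j W i j * sq (x j - y) =
    sq (m - y) + \sum_j W i j * sq (x j - m) by exact: variance_identity.
have yE : y - c = (1 - b) *: (x i - c) + b *: (m - c).
  rewrite /y /mixed !scalerBr addrACA -opprD -scalerDl subrK scale1r.
  by [].
have xy : x i - y = b *: (x i - m).
  rewrite /y /mixed -/m scalerBl scale1r scalerBr opprD opprB addrA.
  by rewrite [x i + _]addrCA subrr addr0.
have my : m - y = (b - 1) *: (x i - m).
  by rewrite -(subrKA (x i)) xy -opprB -scaleN1r -scalerDl addrC.
have expand : sq (y - c) = (1 - b) * sq (x i - c) + b * sq (m - c)
    - b * (1 - b) * sq (x i - m).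
  rewrite yE; have -> : x i - m = (x i - c) - (m - c).
    by rewrite opprB addrA subrK.
  rewrite (sqB (x i - c) (m - c)) (sqD (_ *: _)) !sqZ dotvZl dotvZr; ring.
have pair : \sum_j W i j * sq (x i - x j) <=
    2 * sq (x i - y) + 2 * \sum_j W i j * sq (x j - y).
  apply: (@le_trans _ _ (\sum_j W i j * (2 * sq (x i - y) + 2 * sq (x j - y)))).
    apply: ler_sum => j _; rewrite ler_wpM2l//.
    rewrite -(subrKA y) (sq_distC (x j)); exact: sqD_le.
  under eq_bigr do rewrite mulrDr; rewrite big_split/= -big_distrl/= W_row mul1r.
  by rewrite lerD2l big_distrr/=; apply: ler_sum => j _; rewrite mulrCA.
have mm0 : 0 <= \sum_j W i j * sq (x j - m).
  by apply: sumr_ge0 => j _; rewrite mulr_ge0 ?sq_ge0.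
move: pair; rewrite vary xy my !sqZ => pair.
rewrite varc expand.
set s := \sum_j W i j * sq (x i - x j) in pair *.
set A := \sum_j W i j * sq (x j - m) in pair mm0 *.
set q := sq (x i - m) in pair *.
have q0 : 0 <= q by exact: sq_ge0.
have : b / 2 * s <= b / 2 * (2 * (b ^+ 2 * q) + 2 * ((b - 1) ^+ 2 * q + A)).
  by rewrite ler_wpM2l// divr_ge0.
have : b * ((b ^+ 2 + (b - 1) ^+ 2) * q) <= b * ((1 - b) * q).
  rewrite ler_wpM2l// ler_wpM2r//; nra.
lra.
Qed.

(** Expansion of the square around the average [mixed b x i].  The subgradient is
    taken at [x i] and not at the average; the difference is the drift of the
    averaging, paid for by a quarter of the dissipation of [mixed_dissipation]. *)
Lemma agent_descent a b x e g c i : 0 <= b -> sq (g i) <= L ^+ 2 ->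
  sq (stepped a b x e g i - c) <=
  sq (mixed b x i - c) + 2 * b * dotv (e i) (mixed b x i - c)
  - 2 * a * dotv (g i) (x i - c) + b / 8 * (\sum_j W i j * sq (x i - x j))
  + 2 * b ^+ 2 * sq (e i) + (8 * a ^+ 2 * b + 2 * a ^+ 2) * L ^+ 2.
Proof.
move=> b0 gL; set y := mixed b x i.
have -> : stepped a b x e g i - c = (y - c) + (b *: e i - a *: g i).
  by rewrite /stepped -/y [RHS]addrA [LHS]addrAC; congr (_ - _); rewrite addrAC.
have crossE : dotv (y - c) (b *: e i - a *: g i) =
    b * dotv (e i) (y - c) - a * dotv (g i) (y - c).
  by rewrite [LHS]dotvC dotvDl dotvNl !dotvZl.
rewrite (sqD (y - c)) crossE.
have quad : sq (b *: e i - a *: g i) <= 2 * (b ^+ 2 * sq (e i)) + 2 * (a ^+ 2 * L ^+ 2).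
  apply: (le_trans (sqD_le _ _)); rewrite sqN !sqZ lerD2l ler_wpM2l//.
  by rewrite ler_wpM2l// sqr_ge0.
have drift : - (2 * a) * dotv (g i) (y - x i) <=
    b / 8 * (\sum_j W i j * sq (x i - x j)) + 8 * a ^+ 2 * b * L ^+ 2.
  have -> : y - x i = b *: \sum_j W i j *: (x j - x i).
    under eq_bigr do rewrite scalerBr.
    rewrite sumrB -scaler_suml W_row scale1r /y /mixed scalerBl scale1r scalerBr.
    by rewrite addrAC [X in X + _]addrAC subrr add0r addrC.
  rewrite dotvZr dotv_sumr.
  have -> : 8 * a ^+ 2 * b * L ^+ 2 = b * \sum_j W i j * (8 * a ^+ 2 * L ^+ 2).
    by rewrite -big_distrl/= W_row mul1r; ring.
  rewrite mulrCA [b / 8]mulrC -[8^-1 * b * _]mulrA [8^-1 * _]mulrCA -mulrDr ler_wpM2l//.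
  rewrite !big_distrr/= -big_split/=; apply: ler_sum => j _.
  rewrite dotvZr [8^-1 * _]mulrCA -mulrDr mulrCA ler_wpM2l//.
  (* the weight 8 leaves the fraction 1 / 8 of the squared distance *)
have := @young_dotv _ _ 8 (a *: g i) (x i - x j) ltac:(lra).
  rewrite dotvZl sqZ -[x i - x j]opprB dotvNr sqN.
  have : a ^+ 2 * sq (g i) <= a ^+ 2 * L ^+ 2 by rewrite ler_wpM2l// sqr_ge0.
  by lra.
have split_g : dotv (g i) (y - c) = dotv (g i) (y - x i) + dotv (g i) (x i - c).
  by rewrite -dotvDr addrA subrK.
rewrite split_g; lra.
Qed.

Lemma descent a b delta x e g c i0 :
  0 < b -> b <= 1 / 2 -> 0 < delta ->
  (forall i, sq (g i) <= L ^+ 2) ->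
  wdist (stepped a b x e g) c + 3 / 8 * (b * disagreement x) +
    (2 * a * (\sum_i r i 0 * dotv (g i) (x i - c)) + delta * (b * wdist x (x i0))
      + a ^+ 2 * L ^+ 2 / (delta * b)) <=
  wdist x c + 2 * b * (\sum_i r i 0 * dotv (e i) (mixed b x i - c))
  + delta * (b * wdist x (x i0)) + 2 * b ^+ 2 * wnorm e
  + (8 * a ^+ 2 * b + 2 * a ^+ 2) * L ^+ 2 + a ^+ 2 * L ^+ 2 / (delta * b).
Proof.
move=> b0 b2 del0 gL.
have mean_le : \sum_i r i 0 * ((1 - b) * sq (x i - c) + b * \sum_j W i j * sq (x j - c))
    = wdist x c.
  under eq_bigr do rewrite mulrDr mulrCA [_ * (b * _)]mulrCA.
  rewrite big_split/= -!big_distrr/=.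
  have -> : \sum_i r i 0 * (\sum_j W i j * sq (x j - c)) = wdist x c.
    under eq_bigr do rewrite big_distrr/=.
    rewrite exchange_big/=; apply: eq_bigr => j _.
    by rewrite -W_col big_distrl/=; apply: eq_bigr => i _; rewrite mulrA.
  by rewrite -/(wdist x c); ring.
have main : wdist (stepped a b x e g) c <= \sum_i r i 0 * (
    ((1 - b) * sq (x i - c) + b * \sum_j W i j * sq (x j - c))
    - 3 / 8 * b * (\sum_j W i j * sq (x i - x j))
    + 2 * b * dotv (e i) (mixed b x i - c)
    - 2 * a * dotv (g i) (x i - c)
    + 2 * b ^+ 2 * sq (e i) + (8 * a ^+ 2 * b + 2 * a ^+ 2) * L ^+ 2).
  apply: ler_sum => i _; rewrite ler_wpM2l ?r_ge0//.
  have := mixed_dissipation x c i (ltW b0) b2.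
  have := agent_descent a x e c (ltW b0) (gL i).
  by lra.
have sumE : \sum_i r i 0 * (
    ((1 - b) * sq (x i - c) + b * \sum_j W i j * sq (x j - c))
    - 3 / 8 * b * (\sum_j W i j * sq (x i - x j))
    + 2 * b * dotv (e i) (mixed b x i - c)
    - 2 * a * dotv (g i) (x i - c)
    + 2 * b ^+ 2 * sq (e i) + (8 * a ^+ 2 * b + 2 * a ^+ 2) * L ^+ 2) =
  wdist x c - 3 / 8 * (b * disagreement x)
  + 2 * b * (\sum_i r i 0 * dotv (e i) (mixed b x i - c))
  - 2 * a * (\sum_i r i 0 * dotv (g i) (x i - c))
  + 2 * b ^+ 2 * wnorm e + (8 * a ^+ 2 * b + 2 * a ^+ 2) * L ^+ 2.
  have gen (A B C D F : 'I_n -> R) k1 k2 k3 k4 k5 :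
      \sum_i r i 0 * (A i - k1 * B i + k2 * C i - k3 * D i + k4 * F i + k5) =
      \sum_i r i 0 * A i - k1 * (\sum_i r i 0 * B i) + k2 * (\sum_i r i 0 * C i)
      - k3 * (\sum_i r i 0 * D i) + k4 * (\sum_i r i 0 * F i) + k5.
    rewrite -[in RHS](mul1r k5) -r_sum1 !mulr_suml !mulr_sumr -!sumrN -!big_split/=.
    by apply: eq_bigr => i _; ring.
  by rewrite gen mean_le -[3 / 8 * b * _]mulrA.
rewrite sumE in main; lra.
Qed.

(** Each subgradient is tested at its own point [x i]; passing to the common point
    [x i0] costs [a * L * enorm (x i - x i0)], which is split by Young's inequality
    between the two last terms. *)
Lemma suboptimality_le (f : 'I_n -> 'rV[R]_d -> R) (g : 'I_n -> 'rV[R]_d -> 'rV[R]_d)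
    a b delta x c i0 :
  (forall i u, is_subgradient (f i) u (g i u)) ->
  (forall i u, sq (g i u) <= L ^+ 2) -> 0 <= a -> 0 < b -> 0 < delta ->
  2 * a * (global_cost r f (x i0) - global_cost r f c) <=
  2 * a * (\sum_i r i 0 * dotv (g i (x i)) (x i - c)) + delta * (b * wdist x (x i0))
      + a ^+ 2 * L ^+ 2 / (delta * b).
Proof.
move=> fg gL a0 b0 del0; have db0 : 0 < delta * b by exact: mulr_gt0.
have -> : a ^+ 2 * L ^+ 2 / (delta * b) = \sum_i r i 0 * (a ^+ 2 * L ^+ 2 / (delta * b)).
  by rewrite -big_distrl/= r_sum1 mul1r.
rewrite /global_cost -sumrB /wdist !big_distrr/= -!big_split/=.
apply: ler_sum => i _.
have := fg i (x i) c; have := fg i (x i0) (x i).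
have -> : dotv (g i (x i)) (c - x i) = - dotv (g i (x i)) (x i - c).
  by rewrite -dotvNr opprB.
move=> f1 f2.
have := young_dotv (- (a *: g i (x i0))) (x i - x i0) (_ : 0 < (delta * b)^-1).
rewrite invr_gt0 => /(_ db0); rewrite invrK dotvNl dotvZl sqN sqZ => yg.
have ag : (delta * b)^-1 * (a ^+ 2 * sq (g i (x i0))) <= a ^+ 2 * L ^+ 2 / (delta * b).
  rewrite mulrC ler_wpM2r ?invr_ge0 ?(ltW db0)// ler_wpM2l// sqr_ge0//.
have fa1 := ler_wpM2l a0 f1; have fa2 := ler_wpM2l a0 f2.
have inner : 2 * a * f i (x i0) - 2 * a * f i c <= 2 * a * dotv (g i (x i)) (x i - c)
   + delta * (b * sq (x i - x i0)) + a ^+ 2 * L ^+ 2 / (delta * b).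
  move: yg ag fa1 fa2; rewrite !mulrDr !mulrN; lra.
have := ler_wpM2l (ltW (r_gt0 i)) inner; rewrite !mulrDr; lra.
Qed.

End one_step.

(** * Consensus error over a connected window *)
Lemma mem_bigcup_nat (S : finType) (E : nat -> {set S}) m n z :
  z \in (\bigcup_(m <= k < n) E k)%SET -> exists2 k, (m <= k < n)%N & z \in E k.
Proof.
rewrite big_nat; elim/big_rec: _ => [|k A kmn IH]; first by rewrite inE.
by rewrite inE => /orP[zk|/IH//]; exists k.
Qed.

Section connectivity.
Context {R : realType} {n d : nat}.

Lemma enorm_connect_le (e : rel 'I_n) (x : 'I_n -> 'rV[R]_d) (c : R) i j :
  0 <= c -> (forall u v, e u v -> enorm (x u - x v) <= c) ->
  connect e i j -> enorm (x i - x j) <= n%:R * c.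
Proof.
move=> c0 ec /connectP[p ep ->]; case/shortenP: ep => p' ep' up' _.
have szp : (size p' <= n)%N.
  have := max_card (mem (i :: p')); rewrite card_ord (card_uniqP up') /=.
  exact: ltnW.
apply: (@le_trans _ _ ((size p')%:R * c)); last by rewrite ler_wpM2r// ler_nat.
elim: p' i ep' {up' szp} => [|u p' IHp] i /=.
  by move=> _; rewrite subrr /enorm -(scale0r (x i)) dotvZl mul0r sqrtr0 mul0r.
move=> /andP[eiu /IHp IH]; rewrite -natr1 mulrDl mul1r [leRHS]addrC.
by apply: (le_trans (enorm_triangle (x u) _ _)); rewrite lerD// ec.
Qed.

Lemma enorm_drift_le (x : nat -> 'rV[R]_d) (c : R) (s t : nat) :
  (s <= t)%N -> (forall k, (s <= k < t)%N -> enorm (x k.+1 - x k) <= c) ->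
  enorm (x t - x s) <= (t - s)%:R * c.
Proof.
move=> st; rewrite -{1 2}(subnK st); elim: (t - s)%N => [|k IHk] xc.
  by rewrite add0n subrr /enorm -(scale0r (x s)) dotvZl mul0r sqrtr0 mul0r.
apply: (le_trans (enorm_triangle (x (k + s)%N) _ _)).
rewrite -natr1 mulrDl mul1r [leRHS]addrC lerD//.
  by rewrite addSn; apply: xc; rewrite leq_addl addSn ltnSn.
by apply: IHk => l /andP[sl lk]; apply: xc; rewrite sl/= addSn ltnS ltnW.
Qed.

Variables (r : 'cV[R]_n) (W : nat -> 'M[R]_n) (E : nat -> {set 'I_n * 'I_n}).
Variables (L eta : R) (B : nat) (alpha beta : nat -> R).
Hypothesis r_gt0 : forall i, 0 < r i 0.
Hypothesis r_sum1 : \sum_i r i 0 = 1.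
Hypothesis W_ge0 : forall t i j, (0 < t)%N -> 0 <= W t i j.
Hypothesis W_row : forall t i, (0 < t)%N -> \sum_j W t i j = 1.
Hypothesis eta_gt0 : 0 < eta.
Hypothesis W_eta : forall i j t, (0 < t)%N -> (j, i) \in E t -> eta <= W t i j.
Hypothesis E_conn : forall t, (0 < t)%N ->
  strongly_connected (\bigcup_(t.+1 <= k < (t + B).+1) E k)%SET.
Hypothesis beta_ge0 : forall t, (0 < t)%N -> 0 <= beta t.
Hypothesis beta_le1 : forall t, (0 < t)%N -> beta t <= 1.

(** A multiple [rho] of the square root of the sum over the window bounds, during
    the window, the distance between the ends of an active edge and between two
    successive positions of an agent.  Two agents joined by an edge at some time of
    the window are at distance at most [(2 * B + 1) * rho] at time [t], and a path
    of the union graph has at most [n] edges. *)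
Lemma disagreement_window : exists2 K : R, 0 <= K &
  forall (x e g : nat -> 'I_n -> 'rV[R]_d),
  (forall t i, (0 < t)%N -> x t.+1 i = stepped (W t) (alpha t) (beta t) (x t) (e t) (g t) i) ->
  (forall t i, (0 < t)%N -> sq (g t i) <= L ^+ 2) ->
  forall i0 t, (B.+2 <= t)%N -> wdist r (x t) (x t i0) <= K * \sum_(k < B)
    (disagreement r (W (t - k.+1)%N) (x (t - k.+1)%N)
     + beta (t - k.+1)%N ^+ 2 * wnorm r (e (t - k.+1)%N) + alpha (t - k.+1)%N ^+ 2).
Proof.
have [rm rm0 rmle] : exists2 rm : R, 0 < rm & forall i, rm <= r i 0.
  exists (\big[Num.min/1]_i r i 0).
    by elim/big_rec: _ => // i m _ m0; rewrite lt_min r_gt0.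
  by move=> i; rewrite (bigD1 i)//= ge_min lexx.
pose C := (rm * eta)^-1 + 3 / rm + 3 * L ^+ 2.
have C1 : 0 <= (rm * eta)^-1 by rewrite invr_ge0 mulr_ge0// ltW.
have C2 : 0 <= 3 / rm by rewrite divr_ge0// ltW.
have C3 : 0 <= 3 * L ^+ 2 by rewrite mulr_ge0// sqr_ge0.
have C0 : 0 <= C by rewrite !addr_ge0.
exists ((n%:R * (2 * B%:R + 1)) ^+ 2 * C).
  by rewrite mulr_ge0// sqr_ge0.
move=> x e g dyn gL i0 t Bt.
pose u s := disagreement r (W s) (x s) + beta s ^+ 2 * wnorm r (e s) + alpha s ^+ 2.
have q0 s : (0 < s)%N -> 0 <= disagreement r (W s) (x s).
  by move=> s0; apply: disagreement_ge0 => // i j; exact: W_ge0.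
have bn0 s : 0 <= beta s ^+ 2 * wnorm r (e s).
  by rewrite mulr_ge0 ?sqr_ge0// wnorm_ge0.
have u0 s : (0 < s)%N -> 0 <= u s by move=> s0; rewrite !addr_ge0 ?q0 ?sqr_ge0.
have tk (k : 'I_B) : (0 < t - k.+1)%N.
  by rewrite subn_gt0 (leq_trans _ Bt)// !ltnS ltnW.
set S := \sum_(k < B) _.
have S0 : 0 <= S by apply: sumr_ge0 => k _; exact: u0.
have uS s : (t - B <= s < t)%N -> u s <= S.
  move=> st; have kB : (t - s.+1 < B)%N by (clear -st; lia).
  rewrite /S (bigD1 (Ordinal kB))//= (_ : t - (t - s.+1).+1 = s)%N; last by (clear -st; lia).
  by rewrite lerDl sumr_ge0// => k _; exact: u0.
pose rho := Num.sqrt (C * S).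
have rho0 : 0 <= rho by exact: sqrtr_ge0.
have win_gt0 s : (t - B <= s < t)%N -> (0 < s)%N by (clear -Bt; lia).
have edge s i j : (t - B <= s < t)%N -> (j, i) \in E s -> enorm (x s i - x s j) <= rho.
  move=> st ji; have s0 := win_gt0 _ st.
  apply: enorm_le_sqrt; apply: (@le_trans _ _ ((rm * eta)^-1 * S)); last first.
    by rewrite ler_wpM2r// /C; lra.
  rewrite ler_pdivlMl ?mulr_gt0//; apply: le_trans (uS _ st).
  apply: (@le_trans _ _ (disagreement r (W s) (x s))); last first.
    by rewrite /u -addrA lerDl addr_ge0// sqr_ge0.
  rewrite /disagreement [leRHS](bigD1 i)//= -[leLHS]addr0 lerD//; last first.
    apply: sumr_ge0 => k _; rewrite mulr_ge0 ?(ltW (r_gt0 _))// sumr_ge0// => l _.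
    by rewrite mulr_ge0 ?sq_ge0 ?W_ge0.
  rewrite -mulrA ler_pM ?(ltW rm0) ?mulr_ge0 ?(ltW eta_gt0) ?sq_ge0//.
  rewrite (bigD1 j)//= -[leLHS]addr0 lerD ?ler_wpM2r ?sq_ge0 ?W_eta//.
  by apply: sumr_ge0 => k _; rewrite mulr_ge0 ?sq_ge0 ?W_ge0.
have move_le s i : (t - B <= s < t)%N -> enorm (x s.+1 i - x s i) <= rho.
  move=> st; have s0 := win_gt0 _ st.
  apply: enorm_le_sqrt.
  have diffE : x s.+1 i - x s i = (beta s *: \sum_j W s i j *: (x s j - x s i)
      + beta s *: e s i) - alpha s *: g s i.
    rewrite dyn// /stepped /mixed; under [in RHS]eq_bigr do rewrite scalerBr.
    rewrite sumrB -scaler_suml W_row// scale1r scalerBl scale1r scalerBr.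
    by rewrite -!(addrA (x s i)) addrCA subrr addr0 (addrC (- _)).
  have sq3 (a b c : 'rV[R]_d) : sq (a + b - c) <= 3 * sq a + 3 * sq b + 3 * sq c.
    have := sq_ge0 (a - b); have := sq_ge0 (a + c); have := sq_ge0 (b + c).
    by rewrite !sqD !sqN !dotvNr dotvDl; lra.
  have jensen : sq (\sum_j W s i j *: (x s j - x s i)) <=
      \sum_j W s i j * sq (x s i - x s j).
    apply: (le_trans (sq_mean_le _ _ _)); [by move=> j; exact: W_ge0|exact: W_row|].
    by apply: ler_sum => j _; rewrite (sq_distC (x s j)).
  have q_i : rm * (\sum_j W s i j * sq (x s i - x s j)) <= disagreement r (W s) (x s).
    rewrite /disagreement [leRHS](bigD1 i)//= -[leLHS]addr0 lerD//.
      apply: ler_wpM2r => //; apply: sumr_ge0 => l _.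
      by rewrite mulr_ge0 ?sq_ge0 ?W_ge0.
    apply: sumr_ge0 => k _; rewrite mulr_ge0 ?(ltW (r_gt0 _))// sumr_ge0// => l _.
    by rewrite mulr_ge0 ?sq_ge0 ?W_ge0.
  have e_i : rm * sq (e s i) <= wnorm r (e s).
    rewrite /wnorm [leRHS](bigD1 i)//= -[leLHS]addr0 lerD//.
      by apply: ler_wpM2r => //; exact: sq_ge0.
    by apply: sumr_ge0 => k _; rewrite mulr_ge0 ?(ltW (r_gt0 _)) ?sq_ge0.
  have b01 : beta s ^+ 2 <= 1 by rewrite expr_le1 ?beta_ge0 ?beta_le1.
  have bM : beta s ^+ 2 * sq (\sum_j W s i j *: (x s j - x s i)) <=
      rm^-1 * disagreement r (W s) (x s).
    rewrite ler_pdivlMl//; apply: le_trans q_i; rewrite ler_pM2l//.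
    by apply: le_trans jensen; rewrite ler_piMl ?sq_ge0.
  have be : beta s ^+ 2 * sq (e s i) <= rm^-1 * (beta s ^+ 2 * wnorm r (e s)).
    by rewrite ler_pdivlMl// mulrCA ler_wpM2l ?sqr_ge0.
  have ag : alpha s ^+ 2 * sq (g s i) <= alpha s ^+ 2 * L ^+ 2.
    by rewrite ler_wpM2l ?sqr_ge0// gL.
  apply: (@le_trans _ _ (C * u s)); last by rewrite ler_wpM2l// uS.
  rewrite diffE; apply: (le_trans (sq3 _ _ _)); rewrite !sqZ.
  have rm'0 : 0 <= rm^-1 by rewrite invr_ge0 ltW.
  have := mulr_ge0 rm'0 (sqr_ge0 (alpha s)).
  have := mulr_ge0 C3 (q0 _ s0); have := mulr_ge0 C3 (bn0 s).
  have := mulr_ge0 C1 (u0 _ s0).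
  by rewrite /C /u; lra.
have B0 : 0 <= 2 * B%:R + 1 :> R by rewrite addr_ge0 ?mulr_ge0 ?ler0n.
have pair_le i : enorm (x t i - x t i0) <= n%:R * ((2 * B%:R + 1) * rho).
  have t1 : (0 < t - B.+1)%N by rewrite subn_gt0.
  apply: (enorm_connect_le (x := x t) _ _ (E_conn t1 i i0)).
    exact: mulr_ge0.
  move=> v w /= /mem_bigcup_nat[s st vw].
  have st' : (t - B <= s < t)%N by (clear -Bt st; lia).
  have far l : enorm (x t l - x s l) <= B%:R * rho.
    apply: le_trans (_ : (t - s)%:R * rho <= _); last first.
      by rewrite ler_wpM2r// ler_nat; clear -st'; lia.
    apply: (enorm_drift_le (x := fun k => x k l)); first by case/andP: st' => _ /ltnW.
    by move=> k kst; apply: move_le; clear -kst st'; lia.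
  apply: (le_trans (enorm_triangle (x s v) _ _)).
  have := enorm_triangle (x s w) (x s v) (x t w).
  have := edge _ _ _ st' vw; have := far v; have := far w.
  rewrite (enorm_distC (x s w) (x s v)) (enorm_distC (x s w) (x t w)).
  by lra.
have sq_le i : sq (x t i - x t i0) <= (n%:R * (2 * B%:R + 1)) ^+ 2 * C * S.
  rewrite -enorm_sqr -mulrA -(@sqr_sqrtr _ (C * S)) ?mulr_ge0// -exprMn -mulrA.
  by rewrite ler_sqr ?nnegrE ?enorm_ge0 ?mulr_ge0 ?ler0n.
apply: (@le_trans _ _ (\sum_i r i 0 * ((n%:R * (2 * B%:R + 1)) ^+ 2 * C * S))).
  by apply: ler_sum => i _; apply: ler_wpM2l; [exact: ltW|exact: sq_le].
by rewrite -big_distrl/= r_sum1 mul1r.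
Qed.

End connectivity.

(** * Convergence to a minimizer along one trajectory *)
Section norms.
Context {R : realType} {d : nat}.
Implicit Types v : 'rV[R]_d.

Lemma coord_le_enorm v k : `|v 0 k| <= enorm v.
Proof.
rewrite -ler_sqr ?nnegrE ?enorm_ge0// enorm_sqr real_normK ?num_real//.
rewrite /sq /dotv (bigD1 k)//= -expr2 lerDl sumr_ge0// => l _.
by rewrite -expr2 sqr_ge0.
Qed.

Lemma coord_le_norm v k : `|v 0 k| <= `|v|.
Proof.
have /mapP[j Hj E] : `|v 0 k| \in [seq `|v x.1 x.2| | x : 'I_1 * 'I_d].
  by apply/mapP; exists (ord0, k) => //=; rewrite mem_enum.
by rewrite E [leRHS]/Num.norm /= mx_normrE; apply/bigmax_geP; right => /=; exists j.
Qed.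

Lemma norm_le_enorm v : `|v| <= enorm v.
Proof.
have [->|v0] := eqVneq v 0; first by rewrite normr0 enorm_ge0.
have : mx_norm v != 0 by apply: contra_neq v0; exact: mx_norm_eq0.
move=> /mx_norm_neq0[[i k] /= E]; rewrite [leLHS]/Num.norm/= E (ord1 i).
exact: coord_le_enorm.
Qed.

Lemma sq_le_norm v : sq v <= d%:R * `|v| ^+ 2.
Proof.
have -> : d%:R * `|v| ^+ 2 = \sum_(k < d) `|v| ^+ 2.
  by rewrite sumr_const card_ord mulr_natl.
apply: ler_sum => k _.
rewrite -expr2 -real_normK ?num_real// ler_sqr ?nnegrE//.
exact: coord_le_norm.
Qed.

End norms.

Section endgame.
Context {R : realType} {n d : nat}.
Variables (r : 'cV[R]_n).
Hypothesis r_gt0 : forall i, 0 < r i 0.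
Hypothesis r_sum1 : \sum_i r i 0 = 1.

Lemma wdist_expand (x : 'I_n -> 'rV[R]_d) c :
  wdist r x c = \sum_i r i 0 * sq (x i) - 2 * (\sum_i r i 0 * dotv (x i) c) + sq c.
Proof.
have -> : sq c = \sum_i r i 0 * sq c by rewrite -mulr_suml r_sum1 mul1r.
rewrite mulr_sumr -sumrN -!big_split/=.
by apply: eq_bigr => i _; rewrite sqB; ring.
Qed.

Lemma wdist_affine (k : nat) (x : 'I_n -> 'rV[R]_d) (c : 'I_k -> 'rV[R]_d) (lam : 'I_k -> R) :
  \sum_j lam j = 1 ->
  wdist r x (\sum_j lam j *: c j) - sq (\sum_j lam j *: c j) =
  \sum_j lam j * (wdist r x (c j) - sq (c j)).
Proof.
move=> lam1; rewrite wdist_expand addrK.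
under [RHS]eq_bigr do rewrite wdist_expand addrK mulrBr.
rewrite sumrB -mulr_suml lam1 mul1r; congr (_ - _).
under [RHS]eq_bigr do rewrite mulrCA.
rewrite -mulr_sumr; congr (_ * _).
under [RHS]eq_bigr do rewrite mulr_sumr.
rewrite exchange_big/=; apply: eq_bigr => i _.
rewrite dotv_sumr mulr_sumr; apply: eq_bigr => j _.
by rewrite dotvZr mulrCA.
Qed.

(** Points are lifted to the hyperplane of last coordinate 1, where affine
    combinations are the linear ones; a family of lifted points of maximal rank
    spans all the others. *)
Lemma affine_basis (A : set 'rV[R]_d) :
  exists (k : nat) (c : 'I_k -> 'rV[R]_d), (forall j, A (c j)) /\
    forall a, A a -> exists2 lam : 'I_k -> R,
      \sum_j lam j = 1 & a = \sum_j lam j *: c j.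
Proof.
pose lift (a : 'rV[R]_d) : 'rV[R]_(d + 1) := row_mx a 1.
pose good k (S : 'M[R]_(k, d + 1)) := forall j, exists2 a, A a & row j S = lift a.
pose P m := `[< exists k (S : 'M[R]_(k, d + 1)), good k S /\ \rank S = m >].
have P0 : exists m, P m.
  exists 0%N; apply/asboolP; exists 0%N, 0; split; first by case.
  by rewrite mxrank0.
have Pub m : P m -> (m <= d + 1)%N.
  by move=> /asboolP[k [S [_ <-]]]; exact: rank_leq_col.
case: (ex_maxnP P0 Pub) => m /asboolP[k [S [gS rS]]] mmax.
have /choice[c cS] j : exists a, A a /\ row j S = lift a.
  by have [a Aa aE] := gS j; exists a.
exists k, c; split=> [j|a Aa]; first by have [] := cS j.
have aS : (lift a <= S)%MS.
  have good' : good (k + 1)%N (col_mx S (lift a)).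
    move=> j; case: (splitP j) => i jE.
      have [b Ab bE] := gS i; exists b => //; rewrite -bE.
      by rewrite (_ : j = lshift 1 i) ?rowKu//; apply: val_inj.
    exists a => //; rewrite (_ : j = rshift k i); last exact: val_inj.
    by rewrite rowKd row_id.
  have : (\rank (col_mx S (lift a)) <= m)%N.
    by apply: mmax; apply/asboolP; exists (k + 1)%N, (col_mx S (lift a)).
  rewrite -rS => le_rank.
  have subS : (S <= col_mx S (lift a))%MS by rewrite -addsmxE addsmxSl.
  have : (col_mx S (lift a) <= S)%MS by rewrite -(geq_leqif (mxrank_leqif_sup subS)).
  by apply: submx_trans; rewrite -addsmxE addsmxSr.
have /submxP[l lE] := aS.
have lE' : lift a = \sum_j l 0 j *: lift (c j).
  rewrite lE mulmx_sum_row; apply: eq_bigr => j _.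
  by have [_ ->] := cS j.
exists (fun j => l 0 j).
  have := congr1 (fun M : 'rV[R]_(d + 1) => M 0 (rshift d 0)) lE'.
  rewrite /lift row_mxEr mxE eqxx summxE => one; apply: etrans (esym one);
    apply: eq_bigr => j _.
  by rewrite mxE row_mxEr mxE eqxx mulr1.
apply/rowP => q; have := congr1 (fun M : 'rV[R]_(d + 1) => M 0 (lshift 1 q)) lE'.
rewrite /lift row_mxEl summxE => ->; rewrite summxE; apply: eq_bigr => j _.
by rewrite mxE row_mxEl mxE.
Qed.

Lemma cvg_wdist_affine (k : nat) (x : nat -> 'I_n -> 'rV[R]_d) (c : 'I_k -> 'rV[R]_d)
    (lam : 'I_k -> R) : \sum_j lam j = 1 ->
  (forall j, cvgn (fun t => wdist r (x t) (c j))) ->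
  cvgn (fun t => wdist r (x t) (\sum_j lam j *: c j)).
Proof.
move=> lam1 xc.
have -> : (fun t => wdist r (x t) (\sum_j lam j *: c j)) =
    (fun t => \sum_j lam j * (wdist r (x t) (c j) - sq (c j)) + sq (\sum_j lam j *: c j)).
  by apply/funext => t; rewrite -wdist_affine// subrK.
have /choice[l lP] j : exists l : R, (fun t => wdist r (x t) (c j)) @ \oo --> l.
  by have /cvg_ex := xc j.
apply/cvg_ex; exists (\sum_j lam j * (l j - sq (c j)) + sq (\sum_j lam j *: c j)).
apply: cvgD; last exact: cvg_cst.
apply: cvg_big => [|j _]; first exact: add_continuous.
 apply: cvgM; first exact: cvg_cst.
by apply: cvgB; [exact: lP|exact: cvg_cst].
Qed.

Variables (f : 'I_n -> 'rV[R]_d -> R) (g : 'I_n -> 'rV[R]_d -> 'rV[R]_d) (L : R).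
Hypothesis fg : forall i u, is_subgradient (f i) u (g i u).
Hypothesis gL : forall i u, enorm (g i u) <= L.

Lemma global_cost_lipschitz u v :
  global_cost r f u <= global_cost r f v + L * enorm (v - u).
Proof.
have -> : L * enorm (v - u) = \sum_i r i 0 * (L * enorm (v - u)).
  by rewrite -mulr_suml r_sum1 mul1r.
rewrite -big_split/=; apply: ler_sum => i _; rewrite -mulrDr ler_wpM2l ?(ltW (r_gt0 _))//.
have := fg i u v; have := cauchy_schwarz_dotv (- g i u) (v - u).
have : enorm (g i u) * enorm (v - u) <= L * enorm (v - u).
  by rewrite ler_wpM2r ?enorm_ge0.
by rewrite dotvNl enormN; lra.
Qed.

(** At the good times x_i0 stays in a compact box because [wdist r (x t) c0]
    converges; a cluster point [p] is a minimizer by continuity of the cost, and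
    the limit of [wdist r (x t) p] is 0 since it is approached at good times. *)
Lemma cvg_to_minimizer (x : nat -> 'I_n -> 'rV[R]_d) (i0 : 'I_n) (c0 : 'rV[R]_d) :
  argmin (global_cost r f) c0 ->
  (forall c, argmin (global_cost r f) c -> cvgn (fun t => wdist r (x t) c)) ->
  (forall eps N, 0 < eps -> exists2 t, (N <= t)%N &
     global_cost r f (x t i0) - global_cost r f c0 < eps /\
     wdist r (x t) (x t i0) < eps) ->
  exists2 p, argmin (global_cost r f) p & forall i, (fun t => x t i) @ \oo --> p.
Proof.
move=> c0min Vcvg freq.
have wterm (z : 'I_n -> 'rV[R]_d) c i : r i 0 * sq (z i - c) <= wdist r z c.
  rewrite /wdist (bigD1 i)//= lerDl sumr_ge0// => j _.
  by rewrite mulr_ge0 ?sq_ge0 ?(ltW (r_gt0 _)).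
have [M Mbnd] : exists M, forall t, enorm (x t i0 - c0) <= M.
  have /cvg_seq_bounded[M0 [_ M0b]] := Vcvg _ c0min.
  exists (Num.sqrt ((M0 + 1) / r i0 0)) => t; apply: enorm_le_sqrt.
  rewrite ler_pdivlMr// mulrC; apply: (le_trans (wterm _ _ _)).
  apply: (le_trans (ler_norm _)); apply: (M0b (M0 + 1) _ t); first by rewrite ltrDl.
  by [].
have /choice[s sP] (k : nat) : exists t, (k <= t)%N /\
    (global_cost r f (x t i0) - global_cost r f c0 < k.+1%:R^-1 /\
     wdist r (x t) (x t i0) < k.+1%:R^-1).
  by have [|t kt tP] := freq k.+1%:R^-1 k; [rewrite invr_gt0|exists t].
pose box := [set v : 'rV[R]_d | forall i, v ord0 i \in `[c0 0 i - M, c0 0 i + M]].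
have box_compact : compact box.
  apply: (@rV_compact R^o _ (fun i => `[c0 0 i - M, c0 0 i + M]%classic)).
  by move=> i; apply: segment_compact.
have [p [_ pcl]] : box `&` cluster ((fun k => x (s k) i0) @ \oo) !=set0.
  apply: box_compact; exists 0%N => // k _ /= i; rewrite in_itv/=.
  have := le_trans (coord_le_enorm (x (s k) i0 - c0) i) (Mbnd (s k)).
  by rewrite !mxE ler_norml => /andP[]; lra.
have near_p eps N : 0 < eps -> exists2 t, (N <= t)%N &
    [/\ enorm (x t i0 - p) < eps, global_cost r f (x t i0) < global_cost r f c0 + eps &
        wdist r (x t) (x t i0) < eps].
  move=> e0.
  have [K0 _ K0P] : exists2 K0, True & forall k, (K0 <= k)%N -> k.+1%:R^-1 < eps.
    exists (Num.trunc eps^-1) => // k Kk; rewrite invf_plt ?posrE//.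
    by rewrite (lt_le_trans (truncnS_gt _))// ler_nat.
  pose S := [set u | exists2 k, (maxn N K0 <= k)%N & u = x (s k) i0].
  have FS : ((fun k => x (s k) i0) @ \oo) S.
    by exists (maxn N K0) => // k /= Nk; exists k.
  (* the sup-norm ball of radius [eta] lies in the Euclidean ball of radius [eps] *)
  pose eta := eps / (Num.sqrt d%:R + 1).
  have D0 : 0 < Num.sqrt d%:R + 1 :> R by rewrite ltr_wpDl ?sqrtr_ge0.
  have eta0 : 0 < eta by rewrite divr_gt0.
  have [u [[k kN ->] pu]] := pcl _ _ FS (nbhsx_ballx p _ eta0).
  have [ks [gap dis]] := sP k; have kK : (K0 <= k)%N.
    by apply: leq_trans kN; exact: leq_maxr.
  exists (s k); first by apply: leq_trans ks; apply: leq_trans kN; exact: leq_maxl.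
  split.
  - apply: (@le_lt_trans _ _ (Num.sqrt d%:R * eta)).
      apply: le_trans (_ : Num.sqrt (d%:R * eta ^+ 2) <= _); last first.
        by rewrite sqrtrM// sqrtr_sqr ger0_norm ?(ltW eta0).
      apply: enorm_le_sqrt; apply: (le_trans (sq_le_norm _)).
      rewrite ler_wpM2l// ler_sqr ?nnegrE ?(ltW eta0)//.
      by apply: ltW; move: pu; rewrite mx_norm_ball /ball_/= distrC.
    by rewrite /eta mulrA ltr_pdivrMr// mulrC mulrDr mulr1 ltrDl.
  - by rewrite -ltrBlDl (lt_trans gap)// K0P.
  - by rewrite (lt_trans dis)// K0P.
have L0 : 0 <= L by apply: le_trans (gL i0 p); exact: enorm_ge0.
have pmin : argmin (global_cost r f) p.
  move=> y; apply: le_trans (c0min y); apply/ler_addgt0Pr => e e0.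
  have e'0 : 0 < e / (L + 1) by rewrite divr_gt0// ltr_wpDl.
  have [t _ [up gap _]] := near_p _ 0%N e'0.
  apply: (le_trans (global_cost_lipschitz p (x t i0))).
  have : L * enorm (x t i0 - p) <= L * (e / (L + 1)) by rewrite ler_wpM2l// ltW.
  have : L * (e / (L + 1)) + e / (L + 1) = e by field; rewrite gt_eqF// ltr_wpDl.
  lra.
have V_le (z : 'I_n -> 'rV[R]_d) : wdist r z p <= 2 * wdist r z (z i0) + 2 * sq (z i0 - p).
  have -> : 2 * sq (z i0 - p) = \sum_i r i 0 * (2 * sq (z i0 - p)).
    by rewrite -mulr_suml r_sum1 mul1r.
  rewrite /wdist mulr_sumr -big_split/=; apply: ler_sum => i _.
  rewrite mulrCA -mulrDr ler_wpM2l ?(ltW (r_gt0 _))//.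
  by rewrite -(subrKA (z i0)) sqD_le.
have V0 : (fun t => wdist r (x t) p) @ \oo --> (0 : R).
  have /cvg_ex[l Vl] := Vcvg p pmin.
  suff -> : (0 : R) = l by [].
  apply/eqP; rewrite eq_le; apply/andP; split.
    apply: (cvgr_to_ge Vl); apply: nearW => t; exact: wdist_ge0.
  rewrite leNgt; apply/negP => l0.
  have /cvgrPdist_lt/(_ _ (divr_gt0 l0 (ltr0Sn _ 1)))[N _ NP] := Vl.
  have e0 : 0 < Num.min 1 (l / 8) by rewrite lt_min ltr01 divr_gt0.
  have [t Nt [up _ dis]] := near_p _ N e0.
  have := NP t Nt; rewrite ltr_distlC => /andP[Vlow _].
  have u1 : sq (x t i0 - p) < l / 8.
    rewrite -enorm_sqr expr2.
    apply: (@le_lt_trans _ _ (enorm (x t i0 - p))).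
      rewrite ler_piMr ?enorm_ge0//; apply: ltW; apply: (lt_le_trans up).
      by rewrite ge_min lexx.
    by apply: (lt_le_trans up); rewrite ge_min lexx orbT.
  have d1 : wdist r (x t) (x t i0) < l / 8.
    by apply: (lt_le_trans dis); rewrite ge_min lexx orbT.
  have := V_le (x t); lra.
exists p => // i; apply/cvgrPdist_le => e e0.
have re0 : 0 < r i 0 * e ^+ 2 by rewrite mulr_gt0// exprn_gt0.
have /cvgrPdist_lt/(_ _ re0) := V0; apply: filterS => t.
rewrite sub0r normrN ger0_norm; last exact: wdist_ge0.
move=> Vt; rewrite distrC; apply: (le_trans (norm_le_enorm _)).
rewrite -ler_sqr ?nnegrE ?enorm_ge0 ?(ltW e0)// enorm_sqr.
by rewrite -(ler_pM2l (r_gt0 i)); apply: (le_trans (wterm _ _ _)); exact: ltW.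
Qed.

End endgame.

(** * Random vectors *)
Section random_vectors.
Context {disp : measure_display} {T : measurableType disp} {R : realType} {d : nat}.
Implicit Types (Y Z : T -> 'rV[R]_d).

Lemma measurable_fun_sumR (I : Type) (s : seq I) (h : I -> T -> R) :
  (forall i, measurable_fun [set: T] (h i)) ->
  measurable_fun [set: T] (fun w => \sum_(i <- s) h i w).
Proof.
move=> mh; elim: s => [|i s IHs].
  by under eq_fun do rewrite big_nil; exact: measurable_cst.
by under eq_fun do rewrite big_cons; exact: measurable_funD.
Qed.

Lemma random_cst (c : 'rV[R]_d) : random_matrix (fun _ : T => c).
Proof. by move=> i j; exact: measurable_cst. Qed.

Lemma randomD Y Z : random_matrix Y -> random_matrix Z ->
  random_matrix (fun w => Y w + Z w).
Proof.
move=> mY mZ i j; under eq_fun do rewrite mxE.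
exact: measurable_funD.
Qed.

Lemma randomZ (a : R) Y : random_matrix Y -> random_matrix (fun w => a *: Y w).
Proof.
move=> mY i j; under eq_fun do rewrite mxE.
exact: measurable_funM.
Qed.

Lemma randomB Y Z : random_matrix Y -> random_matrix Z ->
  random_matrix (fun w => Y w - Z w).
Proof.
move=> mY mZ; apply: randomD => //.
by under eq_fun do rewrite -scaleN1r; exact: randomZ.
Qed.

Lemma random_sum (I : Type) (s : seq I) (Y : I -> T -> 'rV[R]_d) :
  (forall i, random_matrix (Y i)) -> random_matrix (fun w => \sum_(i <- s) Y i w).
Proof.
move=> mY; elim: s => [|i s IHs].
  by under eq_fun do rewrite big_nil; exact: random_cst.
by under eq_fun do rewrite big_cons; exact: randomD.
Qed.

Lemma measurable_dotv Y Z : random_matrix Y -> random_matrix Z ->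
  measurable_fun [set: T] (fun w => dotv (Y w) (Z w)).
Proof.
by move=> mY mZ; apply: measurable_fun_sumR => k; exact: measurable_funM.
Qed.

Variable P : probability T R.

Definition sqvec Y := forall k, sqintg P (fun w => Y w 0 k).

Lemma sqvec_cst (c : 'rV[R]_d) : sqvec (fun _ => c).
Proof. by move=> k; exact: sqintg_cst. Qed.

Lemma sqvecD Y Z : sqvec Y -> sqvec Z -> sqvec (fun w => Y w + Z w).
Proof. by move=> sY sZ k; under eq_fun do rewrite mxE; exact: sqintgD. Qed.

Lemma sqvecZ (a : R) Y : sqvec Y -> sqvec (fun w => a *: Y w).
Proof. by move=> sY k; under eq_fun do rewrite mxE; exact: sqintgZ. Qed.

Lemma sqvecB Y Z : sqvec Y -> sqvec Z -> sqvec (fun w => Y w - Z w).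
Proof.
move=> sY sZ; apply: sqvecD => //.
by under eq_fun do rewrite -scaleN1r; exact: sqvecZ.
Qed.

Lemma sqvec_sum (I : Type) (s : seq I) (Y : I -> T -> 'rV[R]_d) :
  (forall i, sqvec (Y i)) -> sqvec (fun w => \sum_(i <- s) Y i w).
Proof.
move=> mY; elim: s => [|i s IHs].
  by under eq_fun do rewrite big_nil; exact: sqvec_cst.
by under eq_fun do rewrite big_cons; exact: sqvecD.
Qed.

Lemma sqvec_dotv Y Z : sqvec Y -> sqvec Z -> intg P (fun w => dotv (Y w) (Z w)).
Proof. by move=> sY sZ; apply: intg_sum => k _; exact: sqintgM. Qed.

Lemma sqvec_bounded (L : R) Y : random_matrix Y -> (forall w, enorm (Y w) <= L) ->
  sqvec Y.
Proof.
move=> mY YL k; apply: (@sqintg_bounded _ _ _ P L); first exact: mY.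
by move=> w; apply: le_trans (YL w); exact: coord_le_enorm.
Qed.

Lemma sqvec_enorm Y : random_matrix Y -> intg P (fun w => enorm (Y w) ^+ 2) ->
  sqvec Y.
Proof.
move=> mY iY k; split; first exact: mY.
apply: (intg_le (k := fun w => enorm (Y w) ^+ 2)) => //.
  by apply: measurable_funX; exact: mY.
move=> w; rewrite normrX ler_sqr ?nnegrE ?enorm_ge0//.
exact: coord_le_enorm.
Qed.

(** Turns the centring of the noise, which is given on events of the past, into
    orthogonality to the averaged positions. *)
Lemma centred_dotv (H : set (set T)) (Y Z : T -> 'rV[R]_d) A :
  (forall A, <<s H >> A -> measurable A) ->
  (forall k A, <<s H >> A -> \int[P]_(w in A) Y w 0 k = 0) ->
  random_matrix (T := g_sigma_algebraType H) (Z : g_sigma_algebraType H -> 'rV[R]_d) ->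
  sqvec Y -> sqvec Z -> <<s H >> A ->
  \int[P]_(w in A) dotv (Y w) (Z w) = 0.
Proof.
move=> Hm Y0 mZ sY sZ HA.
have iYZ k : intg P (fun w => Y w 0 k * Z w 0 k) by exact: sqintgM.
have iY k : intg P (fun w => Y w 0 k).
  have [mY iY2] := sY k.
  apply: (intg_le (k := fun w => 1 + Y w 0 k ^+ 2)) => //.
    by apply: intgD => //; exact: (intg_cst P 1).
  move=> w; rewrite -(real_normK (num_real (Y w 0 k))).
  by have := sqr_ge0 (`|Y w 0 k| - 1); have := normr_ge0 (Y w 0 k); nra.
rewrite Rintegral_sum; [|exact: Hm|exact: iYZ].
apply: big1 => k _; apply: (centred_mul Hm) => //; first exact: Y0.
Qed.

End random_vectors.

(** * The dynamics in mean and almost surely *)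
Section mean_descent.
Context {disp : measure_display} {T : measurableType disp} {R : realType}.
Variable P : probability T R.
Context {n d : nat}.
Variables (r : 'cV[R]_n) (W : nat -> 'M[R]_n).
Variables (g : 'I_n -> 'rV[R]_d -> 'rV[R]_d).
Variables (L gamma : R) (alpha beta : nat -> R).
Variables (x e : nat -> 'I_n -> T -> 'rV[R]_d) (x1 : 'I_n -> 'rV[R]_d).
Hypothesis r_gt0 : forall i, 0 < r i 0.
Hypothesis r_sum1 : \sum_i r i 0 = 1.
Hypothesis W_ge0 : forall t i j, (0 < t)%N -> 0 <= W t i j.
Hypothesis W_row : forall t i, (0 < t)%N -> \sum_j W t i j = 1.
Hypothesis W_col : forall t j, (0 < t)%N -> \sum_i r i 0 * W t i j = r j 0.
Hypothesis gL : forall i u, enorm (g i u) <= L.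
Hypothesis alpha_gt0 : forall t, (0 < t)%N -> 0 < alpha t.
Hypothesis beta_gt0 : forall t, (0 < t)%N -> 0 < beta t.
Hypothesis beta_le1 : forall t, (0 < t)%N -> beta t <= 1.
Hypothesis x_random : forall t i, (0 < t)%N -> random_matrix (x t i).
Hypothesis e_random : forall t i, (0 < t)%N -> random_matrix (e t i).
Hypothesis x_init : forall i w, x 1%N i w = x1 i.
Hypothesis dynamics : forall t i w, (0 < t)%N ->
  x t.+1 i w = stepped (W t) (alpha t) (beta t) (x t ^~ w) (e t ^~ w)
                 (fun i => g i (x t i w)) i.

Definition past (t : nat) : set (set T) :=
  [set A | exists s i j (B : set R), [/\ (0 < s <= t)%N, measurable B &
     A = (fun w => (\matrix_(i < n) x s i w) i j) @^-1` B]].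

Hypothesis e_centred : forall t i k A, (0 < t)%N -> <<s past t >> A ->
  \int[P]_(w in A) e t i w 0 k = 0.
Hypothesis e_int : forall t i, (0 < t)%N -> intg P (fun w => enorm (e t i w) ^+ 2).
Hypothesis e_var : forall t i, (0 < t)%N -> \int[P]_w (enorm (e t i w) ^+ 2) <= gamma.

Lemma past_measurable t A : <<s past t >> A -> measurable A.
Proof.
apply: smallest_sub; first exact: sigma_algebra_measurable.
move=> _ [s [i [j [B [/andP[s0 _] mB ->]]]]].
have -> : (fun w => (\matrix_(i < n) x s i w) i j) = (fun w => x s i w 0 j).
  by apply/funext => w; rewrite mxE.
by have := @x_random s i s0 0 j measurableT _ mB; rewrite setTI.
Qed.

Lemma past_mono t : <<s past t >> `<=` <<s past t.+1 >>.
Proof.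
apply: sub_sigma_algebra2 => _ [s [i [j [B [/andP[s0 st] mB ->]]]]].
by exists s, i, j, B; split => //; rewrite s0/= leqW.
Qed.

Local Notation pastType t := (g_sigma_algebraType (past t)).

Lemma x_adapted t i : (0 < t)%N ->
  random_matrix (T := pastType t) (x t i : pastType t -> 'rV[R]_d).
Proof.
move=> t0 a k _ B mB; rewrite setTI; apply: sub_sigma_algebra.
exists t, i, k, B; split => //; first by rewrite t0 /=.
by rewrite (ord1 a); congr (_ @^-1` B); apply/funext => w; rewrite mxE.
Qed.

(** As [g] is an arbitrary selection, measurability of [g i (x t i)] is read off
    from the dynamics, in which every other term is measurable. *)
Lemma g_random t i : (0 < t)%N -> random_matrix (fun w => g i (x t i w)).
Proof.
move=> t0.
have -> : (fun w => g i (x t i w)) = (fun w => (alpha t)^-1 *: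
    (mixed (W t) (beta t) (x t ^~ w) i + beta t *: e t i w - x t.+1 i w)).
  apply/funext => w; rewrite dynamics// /stepped opprB addrC subrK scalerA mulVf ?scale1r//.
  by rewrite gt_eqF ?alpha_gt0.
apply: randomZ; apply: randomB; last exact: x_random.
apply: randomD; last by apply: randomZ; exact: e_random.
apply: randomD; apply: randomZ; first exact: x_random.
by apply: random_sum => j; apply: randomZ; exact: x_random.
Qed.

Lemma g_sqvec t i : (0 < t)%N -> sqvec P (fun w => g i (x t i w)).
Proof. by move=> t0; apply: (@sqvec_bounded _ _ _ _ P L) => //; exact: g_random. Qed.

Lemma e_sqvec t i : (0 < t)%N -> sqvec P (e t i).
Proof. by move=> t0; apply: sqvec_enorm; [exact: e_random|exact: e_int]. Qed.

Lemma mixed_sqvec t i : (0 < t)%N -> (forall j, sqvec P (x t j)) ->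
  sqvec P (fun w => mixed (W t) (beta t) (x t ^~ w) i).
Proof.
move=> t0 sx; apply: sqvecD; apply: sqvecZ => //.
by apply: sqvec_sum => j; exact: sqvecZ.
Qed.

Lemma x_sqvec t i : (0 < t)%N -> sqvec P (x t i).
Proof.
elim: t i => [//|[_ i _|t IHt i _]].
  have -> : x 1%N i = (fun=> x1 i) by apply/funext => w; exact: x_init.
  exact: sqvec_cst.
have -> : x t.+2 i = (fun w => stepped (W t.+1) (alpha t.+1) (beta t.+1)
    (x t.+1 ^~ w) (e t.+1 ^~ w) (fun i => g i (x t.+1 i w)) i).
  by apply/funext => w; exact: dynamics.
apply: sqvecB; last by apply: sqvecZ; exact: g_sqvec.
apply: sqvecD; last by apply: sqvecZ; exact: e_sqvec.
by apply: mixed_sqvec => // j; exact: IHt.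
Qed.

Lemma mixed_adapted t i : (0 < t)%N ->
  random_matrix (T := pastType t)
    ((fun w => mixed (W t) (beta t) (x t ^~ w) i) : pastType t -> 'rV[R]_d).
Proof.
move=> t0; apply: randomD; apply: randomZ; first exact: x_adapted.
by apply: random_sum => j; apply: randomZ; exact: x_adapted.
Qed.

Definition dist2 (c : 'rV[R]_d) t w := wdist r (x t ^~ w) c.
Definition spread (i0 : 'I_n) t w := beta t * wdist r (x t ^~ w) (x t i0 w).
Definition dissip t w := beta t * disagreement r (W t) (x t ^~ w).
(** What the subgradient step gains on [dist2 c], completed by the two terms of
    Young's inequality that make it dominate the suboptimality of [x t i0]; its
    measurability follows from that of the dynamics. *)
Definition gain (delta : R) (i0 : 'I_n) (c : 'rV[R]_d) t w :=
  2 * alpha t * (\sum_i r i 0 * dotv (g i (x t i w)) (x t i w - c))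
  + delta * spread i0 t w + alpha t ^+ 2 * L ^+ 2 / (delta * beta t).
(** The factor is large enough to dominate all the deterministic errors of
    [mean_step] and [mean_spread_window] at once. *)
Definition err (delta : R) t : R :=
  (2 * gamma + 10 * L ^+ 2 + L ^+ 2 / delta + 1) * (beta t ^+ 2 + alpha t ^+ 2 / beta t).

Lemma dist2_int c t : (0 < t)%N -> intg P (dist2 c t).
Proof.
move=> t0; apply: intg_sum => i _; apply: intgZ.
by apply: sqvec_dotv; apply: sqvecB; (exact: x_sqvec || exact: sqvec_cst).
Qed.

Lemma spread_int i0 t : (0 < t)%N -> intg P (spread i0 t).
Proof.
move=> t0; apply: intgZ; apply: intg_sum => i _; apply: intgZ.
by apply: sqvec_dotv; apply: sqvecB; exact: x_sqvec.
Qed.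

Lemma dissip_int t : (0 < t)%N -> intg P (dissip t).
Proof.
move=> t0; apply: intgZ; apply: intg_sum => i _; apply: intgZ.
apply: intg_sum => j _; apply: intgZ.
by apply: sqvec_dotv; apply: sqvecB; exact: x_sqvec.
Qed.

Lemma wnorm_int t : (0 < t)%N -> intg P (fun w => wnorm r (e t ^~ w)).
Proof.
move=> t0; apply: intg_sum => i _; apply: intgZ.
by apply: sqvec_dotv; exact: e_sqvec.
Qed.

Lemma gain_int delta i0 c t : (0 < t)%N -> intg P (gain delta i0 c t).
Proof.
move=> t0; apply: intgD; last exact: (intg_cst P).
apply: intgD; last by apply: intgZ; exact: spread_int.
apply: intgZ; apply: intg_sum => i _; apply: intgZ; apply: sqvec_dotv.
  exact: g_sqvec.
by apply: sqvecB; [exact: x_sqvec|exact: sqvec_cst].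
Qed.

Lemma mean_wnorm_le t : (0 < t)%N -> \int[P]_w wnorm r (e t ^~ w) <= gamma.
Proof.
move=> t0; rewrite /wnorm Rintegral_sum//; last first.
  by move=> i; apply: intgZ; apply: sqvec_dotv; exact: e_sqvec.
apply: (@le_trans _ _ (\sum_i r i 0 * gamma)); last first.
  by rewrite -mulr_suml r_sum1 mul1r.
apply: ler_sum => i _; rewrite RintegralZl//; last first.
  by apply: sqvec_dotv; exact: e_sqvec.
rewrite ler_wpM2l ?(ltW (r_gt0 _))//; apply: le_trans (e_var i t0).
by rewrite le_eqVlt; apply/orP; left; apply/eqP; apply: eq_Rintegral => w _; rewrite enorm_sqr.
Qed.

Lemma spread_ge0 i0 t w : (0 < t)%N -> 0 <= spread i0 t w.
Proof. by move=> t0; rewrite mulr_ge0 ?(ltW (beta_gt0 t0))// wdist_ge0. Qed.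

Lemma dissip_ge0 t w : (0 < t)%N -> 0 <= dissip t w.
Proof.
move=> t0; rewrite mulr_ge0 ?(ltW (beta_gt0 t0))// disagreement_ge0// => i j.
exact: W_ge0.
Qed.

Lemma mean_noise_term c t A : (0 < t)%N -> <<s past t >> A ->
  \int[P]_(w in A) (\sum_i r i 0 * dotv (e t i w) (mixed (W t) (beta t) (x t ^~ w) i - c)) = 0.
Proof.
move=> t0 HA; have mA := past_measurable HA.
have sm i : sqvec P (fun w => mixed (W t) (beta t) (x t ^~ w) i - c).
  apply: sqvecB; last exact: sqvec_cst.
  by apply: mixed_sqvec => // j; exact: x_sqvec.
have ii i : intg P (fun w => dotv (e t i w) (mixed (W t) (beta t) (x t ^~ w) i - c)).
  by apply: sqvec_dotv => //; exact: e_sqvec.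
rewrite Rintegral_sum//; last by move=> i; exact: intgZ.
apply: big1 => i _; rewrite RintegralZl//; last exact: intgS.
rewrite (centred_dotv (P := P) (@past_measurable t)) ?mulr0//.
- by move=> k B HB; exact: e_centred.
- by apply: randomB; [exact: mixed_adapted|exact: random_cst].
- exact: e_sqvec.
Qed.

(** The integral of [descent] over an event of the past, on which the linear noise
    term has mean zero.  The consensus error is bounded by its integral over the
    whole space, so that the increments allowed are the same for all events and all
    points [c]. *)
Lemma mean_step delta i0 c t A : 0 < delta -> (0 < t)%N -> beta t <= 1 / 2 ->
  <<s past t >> A ->
  \int[P]_(w in A) dist2 c t.+1 w + 3 / 8 * \int[P]_(w in A) dissip t w
    + \int[P]_(w in A) gain delta i0 c t w <=
  \int[P]_(w in A) dist2 c t w + delta * (\int[P]_w spread i0 t w) + err delta t.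
Proof.
move=> del0 t0 b2 HA; have mA := past_measurable HA.
have b0 := beta_gt0 t0; have L2 i u : sq (g i u) <= L ^+ 2.
  rewrite -enorm_sqr ler_sqr ?nnegrE ?enorm_ge0//.
  exact: le_trans (enorm_ge0 _) (gL i u).
set a := alpha t; set b := beta t in b0 b2 *.
pose noise w := \sum_i r i 0 * dotv (e t i w) (mixed (W t) b (x t ^~ w) i - c).
pose k0 := (8 * a ^+ 2 * b + 2 * a ^+ 2) * L ^+ 2 + a ^+ 2 * L ^+ 2 / (delta * b).
pose rhs w := dist2 c t w + 2 * b * noise w
  + (delta * spread i0 t w + 2 * b ^+ 2 * wnorm r (e t ^~ w) + k0).
pose lhs w := dist2 c t.+1 w + 3 / 8 * dissip t w + gain delta i0 c t w.
have pw w : lhs w <= rhs w.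
  rewrite /lhs /rhs /dist2 /dissip /gain /spread /k0 -/a -/b /noise.
  have -> : wdist r (x t.+1 ^~ w) c = wdist r (stepped (W t) a b (x t ^~ w)
      (e t ^~ w) (fun i => g i (x t i w))) c.
    by apply: eq_bigr => i _; rewrite dynamics.
  have := descent r_gt0 r_sum1 (fun i j => W_ge0 i j t0) (fun i => W_row i t0)
    (fun j => W_col j t0) a (x t ^~ w) (e t ^~ w) c i0 b0 b2 del0
    (fun i => L2 i (x t i w)).
  by lra.
have inoise : intg P noise.
  apply: intg_sum => i _; apply: intgZ; apply: sqvec_dotv; first exact: e_sqvec.
  apply: sqvecB; last exact: sqvec_cst.
  by apply: mixed_sqvec => // j; exact: x_sqvec.
have iV := dist2_int c t0; have iV' := dist2_int c (ltn0Sn t).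
have iS := spread_int i0 t0; have iN := wnorm_int t0.
have iD := dissip_int t0; have iG := gain_int delta i0 c t0.
have ik : intg P (fun w => delta * spread i0 t w + 2 * b ^+ 2 * wnorm r (e t ^~ w) + k0).
  by apply: intgD; [apply: intgD; exact: intgZ|exact: (intg_cst P k0)].
have LE : \int[P]_(w in A) lhs w <= \int[P]_(w in A) rhs w.
  apply: le_Rintegral => //; apply: intgS => //.
    by apply: intgD => //; apply: intgD => //; exact: intgZ.
  by apply: intgD => //; apply: intgD => //; exact: intgZ.
have lhsE : \int[P]_(w in A) lhs w = \int[P]_(w in A) dist2 c t.+1 w
    + 3 / 8 * \int[P]_(w in A) dissip t w + \int[P]_(w in A) gain delta i0 c t w.
  rewrite RintegralD//; [|apply: intgS => //; apply: intgD => //; exact: intgZ|exact: intgS].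
  rewrite RintegralD//; [|exact: intgS|apply: intgS => //; exact: intgZ].
  by rewrite RintegralZl//; exact: intgS.
have rhsE : \int[P]_(w in A) rhs w = \int[P]_(w in A) dist2 c t w
    + \int[P]_(w in A) (delta * spread i0 t w + 2 * b ^+ 2 * wnorm r (e t ^~ w) + k0).
  rewrite RintegralD//; [|apply: intgS => //; apply: intgD => //; exact: intgZ|exact: intgS].
  rewrite RintegralD//; [|exact: intgS|apply: intgS => //; exact: intgZ].
  rewrite RintegralZl//; last exact: intgS.
  by rewrite mean_noise_term// mulr0 addr0.
have k00 : 0 <= k0.
  rewrite /k0; apply: addr_ge0.
    by rewrite mulr_ge0 ?sqr_ge0// addr_ge0// mulr_ge0 ?sqr_ge0// ?(ltW b0)// mulr_ge0
      ?sqr_ge0.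
  apply: divr_ge0; [exact: mulr_ge0 (sqr_ge0 _) (sqr_ge0 _)|exact: ltW (mulr_gt0 del0 b0)].
have rest : \int[P]_(w in A) (delta * spread i0 t w + 2 * b ^+ 2 * wnorm r (e t ^~ w) + k0)
    <= delta * (\int[P]_w spread i0 t w) + 2 * b ^+ 2 * gamma + k0.
  apply: (@le_trans _ _ (\int[P]_w (delta * spread i0 t w + 2 * b ^+ 2 * wnorm r (e t ^~
    w) + k0))).
    apply: Rintegral_le_setT => // w; apply: addr_ge0 => //; apply: addr_ge0.
      by rewrite mulr_ge0 ?(ltW del0)// spread_ge0.
    exact: mulr_ge0 (mulr_ge0 (ler0n _ 2) (sqr_ge0 _)) (wnorm_ge0 r_gt0 _).
  rewrite RintegralD//; [|apply: intgD; exact: intgZ|exact: (intg_cst P k0)].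
  rewrite RintegralD//; [|exact: intgZ|exact: intgZ].
  rewrite (RintegralZl _ measurableT iS) (RintegralZl _ measurableT iN).
  rewrite Rintegral_cst//.
  have -> : fine (P [set: T]) = 1 by rewrite probability_setT.
  rewrite mulr1.
  rewrite lerD2r lerD2l; apply: ler_wpM2l; last exact: mean_wnorm_le.
  exact: mulr_ge0 (ler0n _ 2) (sqr_ge0 _).
have errb : 2 * b ^+ 2 * gamma + k0 <= err delta t.
  have gamma0 : 0 <= gamma.
    apply: le_trans (e_var i0 t0); apply: Rintegral_ge0 => w _; exact: sqr_ge0.
  rewrite /err /k0 -/a -/b; set u := a ^+ 2 / b.
  have u0 : 0 <= u by rewrite divr_ge0 ?sqr_ge0 ?(ltW b0).
  have au : a ^+ 2 = u * b by rewrite /u divfK// gt_eqF.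
  have -> : a ^+ 2 * L ^+ 2 / (delta * b) = u * (L ^+ 2 / delta).
    by rewrite /u; field; rewrite !gt_eqF.
  rewrite au; have ub : u * b <= u by rewrite ler_piMr// beta_le1.
  have ubb : u * b * b <= u.
    by apply: le_trans ub; rewrite ler_piMr ?beta_le1// mulr_ge0 ?(ltW b0).
  (* the difference of the two sides is a combination of these products *)
  have h1 : 0 <= gamma * u by exact: mulr_ge0.
  have h2 : 0 <= L ^+ 2 * (u - u * b) by rewrite mulr_ge0 ?sqr_ge0 ?subr_ge0.
  have h3 : 0 <= L ^+ 2 * (u - u * b * b) by rewrite mulr_ge0 ?sqr_ge0 ?subr_ge0.
  have h4 : 0 <= L ^+ 2 * b ^+ 2 by rewrite mulr_ge0 ?sqr_ge0.
  have h5 : 0 <= L ^+ 2 / delta * b ^+ 2.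
    by rewrite mulr_ge0 ?sqr_ge0// divr_ge0 ?sqr_ge0 ?(ltW del0).
  have h6 := sqr_ge0 b.
  lra.
rewrite -lhsE; apply: (le_trans LE); rewrite rhsE; lra.
Qed.

Variables (f : 'I_n -> 'rV[R]_d -> R) (K kappa S : R) (B T0 : nat).
Hypothesis fg : forall i u, is_subgradient (f i) u (g i u).
Hypothesis K_ge0 : 0 <= K.
Hypothesis window : forall w i0 t, (B.+2 <= t)%N ->
  wdist r (x t ^~ w) (x t i0 w) <= K * \sum_(k < B)
    (disagreement r (W (t - k.+1)%N) (x (t - k.+1)%N ^~ w)
     + beta (t - k.+1)%N ^+ 2 * wnorm r (e (t - k.+1)%N ^~ w) + alpha (t - k.+1)%N ^+ 2).
Hypothesis beta_noninc : forall s t, (0 < s <= t)%N -> beta t <= beta s.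
Hypothesis T0_ge : (B.+2 <= T0)%N.
Hypothesis beta_half : forall t, (T0 <= t)%N -> beta t <= 1 / 2.
Hypothesis err_sum : forall N,
  \sum_(1 <= t < N) (beta t ^+ 2 + alpha t ^+ 2 / beta t) <= S.
Hypothesis alpha_dvg : forall c M N0, 0 < c -> (0 < N0)%N -> exists N, M < \sum_(N0 <= t
  < N) c * alpha t.
Hypothesis kappa_gt0 : 0 < kappa.
Hypothesis alpha_beta : forall t, (0 < t)%N -> kappa * alpha t <= beta t.

Let delta : R := (4 * (K * B%:R + 1))^-1.

Lemma KB1_gt0 : 0 < 4 * (K * B%:R + 1).
Proof. by rewrite mulr_gt0// ltr_wpDl// mulr_ge0. Qed.

Lemma delta_gt0 : 0 < delta.
Proof. by rewrite invr_gt0 KB1_gt0. Qed.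

Lemma delta_small : delta * K * B%:R <= 1 / 4.
Proof.
rewrite /delta -mulrA mulrC ler_pdivrMr ?KB1_gt0//.
have KB0 : 0 <= K * B%:R by rewrite mulr_ge0.
lra.
Qed.

Lemma gain_ge i0 c t w : (0 < t)%N ->
  2 * alpha t * (global_cost r f (x t i0 w) - global_cost r f c) <= gain delta i0 c t w.
Proof.
move=> t0; apply: (suboptimality_le (L := L) r_gt0 r_sum1 (f := f)) => //.
- move=> i u; rewrite -enorm_sqr ler_sqr ?nnegrE ?enorm_ge0//.
  exact: le_trans (enorm_ge0 _) (gL i u).
- exact: ltW (alpha_gt0 t0).
- exact: beta_gt0.
- exact: delta_gt0.
Qed.

Lemma gain_ge0 i0 c t w : (0 < t)%N -> argmin (global_cost r f) c ->
  0 <= gain delta i0 c t w.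
Proof.
move=> t0 cmin; apply: le_trans (gain_ge i0 c w t0).
by rewrite mulr_ge0 ?subr_ge0 ?mulr_ge0 ?(ltW (alpha_gt0 t0)).
Qed.

Lemma gamma_ge0 (i0 : 'I_n) : 0 <= gamma.
Proof.
apply: le_trans (e_var i0 (ltn0Sn 0)); apply: Rintegral_ge0 => w _.
exact: sqr_ge0.
Qed.

Lemma err_factor_ge1 (i0 : 'I_n) : 1 <= 2 * gamma + 10 * L ^+ 2 + L ^+ 2 / delta + 1.
Proof.
have := gamma_ge0 i0; have := sqr_ge0 L.
have : 0 <= L ^+ 2 / delta by rewrite divr_ge0 ?sqr_ge0 ?(ltW delta_gt0).
lra.
Qed.

Lemma err_base_ge0 t : (0 < t)%N -> 0 <= beta t ^+ 2 + alpha t ^+ 2 / beta t.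
Proof. by move=> t0; rewrite addr_ge0 ?divr_ge0 ?sqr_ge0 ?(ltW (beta_gt0 t0)). Qed.

Lemma err_ge0 (i0 : 'I_n) t : (0 < t)%N -> 0 <= err delta t.
Proof.
move=> t0; apply: mulr_ge0; last exact: err_base_ge0.
exact: le_trans ler01 (err_factor_ge1 i0).
Qed.

Lemma err_bounded (i0 : 'I_n) N : \sum_(1 <= t < N) err delta t <=
  (2 * gamma + 10 * L ^+ 2 + L ^+ 2 / delta + 1) * S.
Proof.
rewrite -mulr_sumr ler_wpM2l//; exact: le_trans ler01 (err_factor_ge1 i0).
Qed.

(** As [beta] is nonincreasing, the weight [beta t] of the consensus error can be
    replaced by the weights of the earlier steps in the window. *)
Lemma mean_spread_window i0 t : (T0 <= t)%N ->
  \int[P]_w spread i0 t w <=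
  K * \sum_(k < B) (\int[P]_w dissip (t - k.+1)%N w + err delta (t - k.+1)%N).
Proof.
move=> Tt; have tk (k : 'I_B) : (0 < t - k.+1)%N.
  by rewrite subn_gt0 (leq_trans _ Tt)// (leq_trans _ T0_ge)// !ltnS ltnW.
have t0 : (0 < t)%N by rewrite (leq_trans _ Tt)// (leq_trans _ T0_ge).
pose u s w := dissip s w + beta s ^+ 2 * wnorm r (e s ^~ w) + alpha s ^+ 2.
have iu s : (0 < s)%N -> intg P (u s).
  move=> s0; apply: intgD; last exact: (intg_cst P).
  by apply: intgD; [exact: dissip_int|apply: intgZ; exact: wnorm_int].
pose s_ (k : 'I_B) := (t - k.+1)%N.
have ius : intg P (fun w => \sum_(k < B) u (s_ k) w).
  by apply: intg_sum => k _; apply: iu; exact: tk.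
apply: (@le_trans _ _ (\int[P]_w (K * \sum_(k < B) u (s_ k) w))).
  apply: le_Rintegral => //; [exact: spread_int|exact: intgZ|].
  move=> w _; rewrite /spread.
  have W1 := window w i0 (leq_trans T0_ge Tt).
  apply: le_trans (ler_wpM2l (ltW (beta_gt0 t0)) W1) _.
  rewrite mulrCA ler_wpM2l// mulr_sumr; apply: ler_sum => k _.
  have bs : beta t <= beta (s_ k) by apply: beta_noninc; rewrite tk leq_subr.
  have b1 := beta_le1 t0; have b0 := ltW (beta_gt0 t0).
  have q0 : 0 <= disagreement r (W (s_ k)) (x (s_ k) ^~ w).
    by apply: disagreement_ge0 => // i j; exact: W_ge0 (tk k).
  rewrite !mulrDr /u; apply: lerD; first apply: lerD.
  - by rewrite /dissip ler_wpM2r.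
  - by rewrite ler_piMl// mulr_ge0 ?sqr_ge0 ?wnorm_ge0.
  - by rewrite ler_piMl// sqr_ge0.
rewrite RintegralZl// ler_wpM2l// Rintegral_sum//; last by move=> k; exact: iu (tk k).
apply: ler_sum => k _; have s0 := tk k; rewrite -/(s_ k) in s0 *.
have b0 := beta_gt0 s0.
rewrite RintegralD//; [|apply: intgD; [exact: dissip_int|apply: intgZ; exact: wnorm_int]
  |exact: (intg_cst P)].
rewrite RintegralD//; [|exact: dissip_int|apply: intgZ; exact: wnorm_int].
rewrite RintegralZl//; last exact: wnorm_int.
rewrite Rintegral_cst//.
have -> : fine (P [set: T]) = 1 by rewrite probability_setT.
rewrite mulr1 -addrA lerD2l.
have N1 : beta (s_ k) ^+ 2 * (\int[P]_w wnorm r (e (s_ k) ^~ w)) <= beta (s_ k) ^+ 2 * gamma.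
  by rewrite ler_wpM2l ?sqr_ge0// mean_wnorm_le.
have A1 : alpha (s_ k) ^+ 2 <= alpha (s_ k) ^+ 2 / beta (s_ k).
  by rewrite ler_peMr ?sqr_ge0// invf_ge1 ?beta_le1.
have := gamma_ge0 i0; rewrite /err.
set A := alpha (s_ k) ^+ 2 / _ in A1 *; set b := beta (s_ k) in b0 N1 *.
move=> g0; have A0 : 0 <= A by apply: le_trans A1; exact: sqr_ge0.
have b20 := sqr_ge0 b.
have h1 := mulr_ge0 g0 A0; have h2 := mulr_ge0 (sqr_ge0 L) A0.
have h3 := mulr_ge0 (sqr_ge0 L) b20.
have LD : 0 <= L ^+ 2 / delta by rewrite divr_ge0 ?sqr_ge0 ?(ltW delta_gt0).
have h4 := mulr_ge0 LD A0; have h5 := mulr_ge0 LD b20; have h6 := mulr_ge0 g0 b20.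
lra.
Qed.

Lemma mean_bounds i0 c : argmin (global_cost r f) c ->
  exists M, forall N, \sum_(T0 <= t < N) \int[P]_w gain delta i0 c t w <= M /\
    \sum_(T0 <= t < N) \int[P]_w spread i0 t w <= M.
Proof.
move=> cmin.
have delta0 := delta_gt0.
have E (t : nat) : (T0 <= t)%N -> (0 < t)%N by move=> Tt;
  rewrite (leq_trans _ Tt)// (leq_trans _ T0_ge).
apply: (absorb_windows (v := fun t => \int[P]_w dist2 c t w)
  (Q := fun t => \int[P]_w dissip t w)
  (b := err delta) (B := B) (K := K) (delta := delta)
  (S := (2 * gamma + 10 * L ^+ 2 + L ^+ 2 / delta + 1) * S)) => //.
- exact: ltnW.
- exact: ltW.
- exact: delta_small.
- by move=> t; apply: Rintegral_ge0 => w _; exact: wdist_ge0.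
- by move=> t t0; apply: Rintegral_ge0 => w _; exact: dissip_ge0.
- by move=> t t0; apply: Rintegral_ge0 => w _; exact: gain_ge0.
- by move=> t; exact: err_ge0.
- exact: err_bounded.
- move=> t Tt; apply: mean_step => //; [exact: E|exact: beta_half|].
  exact: (@measurableT _ (g_sigma_algebraType (past t))).
- by move=> t; exact: mean_spread_window.
Qed.

(** For a minimizer the gain is nonnegative, and [mean_step] becomes the almost
    supermartingale property with summable errors by [mean_bounds]. *)
Lemma dist2_cvg (i0 : 'I_n) c : argmin (global_cost r f) c ->
  {ae P, forall w, cvgn (fun t => dist2 c t w)}.
Proof.
move=> cmin; have [M MP] := mean_bounds i0 cmin.
have delta0 := delta_gt0.
have T00 : (0 < T0)%N by rewrite (leq_trans _ T0_ge).
have pos (t : nat) : (0 < t + T0)%N by rewrite addn_gt0 T00 orbT.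
pose eps t := delta * (\int[P]_w spread i0 (t + T0) w) + err delta (t + T0).
have epsS N : \sum_(t < N) eps t <=
    delta * M + (2 * gamma + 10 * L ^+ 2 + L ^+ 2 / delta + 1) * S.
  rewrite big_split/= -mulr_sumr; apply: lerD.
    rewrite ler_wpM2l ?(ltW delta0)//.
    by rewrite (sum_ord_shift (fun t => \int[P]_w spread i0 t w)); have [] := MP (N + T0)%N.
  rewrite sum_ord_shift; apply: le_trans (err_bounded i0 (N + T0)).
  by apply: ler_sum_nat_widen => // s; exact: err_ge0.
have := almost_supermartingale_cvg (P := P) (H := fun t => past (t + T0))
  (V := fun t => dist2 c (t + T0)) (eps := eps)
  (S := delta * M + (2 * gamma + 10 * L ^+ 2 + L ^+ 2 / delta + 1) * S).
move=> /(_ (fun t A => @past_measurable (t + T0) A) (fun t => @past_mono (t + T0))).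
move=> H1.
have : {ae P, forall w, cvgn (fun t => dist2 c (t + T0) w)}.
  apply: H1 => //.
  - by move=> t w; exact: wdist_ge0.
  - by move=> t; exact: dist2_int.
  - move=> t; apply: measurable_fun_sumR => i; apply: measurable_funM => //.
    by apply: measurable_dotv; apply: randomB; (exact: x_adapted || exact: random_cst).
  - move=> t A HA.
    have := mean_step i0 c delta0 (pos t) (beta_half (leq_addl t T0)) HA.
    have : 0 <= \int[P]_(w in A) gain delta i0 c (t + T0) w.
      by apply: Rintegral_ge0 => w _; exact: gain_ge0.
    have : 0 <= \int[P]_(w in A) dissip (t + T0) w.
      by apply: Rintegral_ge0 => w _; exact: dissip_ge0.
    by rewrite /eps addSn; lra.
apply: filterS => w /cvg_ex[l]; rewrite (cvg_shiftn T0 (fun t => dist2 c t w)) => wl.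
by apply/cvg_ex; exists l.
Qed.

(** Otherwise [gain + spread] would eventually exceed a multiple of [alpha], whose
    series diverges, whereas the series of [gain + spread] has a finite mean. *)
Lemma near_optimal_infinitely_often i0 c : argmin (global_cost r f) c ->
  {ae P, forall w, forall eps N, 0 < eps -> exists2 t, (N <= t)%N &
     global_cost r f (x t i0 w) - global_cost r f c < eps /\
     wdist r (x t ^~ w) (x t i0 w) < eps}.
Proof.
move=> cmin; have [M MP] := mean_bounds i0 cmin.
have T00 : (0 < T0)%N by rewrite (leq_trans _ T0_ge).
have pos (t : nat) : (0 < t + T0)%N by rewrite addn_gt0 T00 orbT.
pose h t w := gain delta i0 c (t + T0) w + spread i0 (t + T0) w.
have delta0 := delta_gt0.
have ih t : intg P (h t) by apply: intgD; [exact: gain_int|exact: spread_int].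
have h0 t w : 0 <= h t w by rewrite addr_ge0 ?gain_ge0 ?spread_ge0.
have hS N : \sum_(t < N) \int[P]_w h t w <= M + M.
  rewrite (eq_bigr (fun t : 'I_N => \int[P]_w gain delta i0 c (t + T0) w
      + \int[P]_w spread i0 (t + T0) w)); last first.
    by move=> t _; rewrite -RintegralD//; [exact: gain_int|exact: spread_int].
  have [gM sM] := MP (N + T0)%N.
  rewrite big_split/= (sum_ord_shift (fun t => \int[P]_w gain delta i0 c t w)).
  by rewrite (sum_ord_shift (fun t => \int[P]_w spread i0 t w)) lerD.
apply: filterS (ae_bounded_series h0 ih hS) => w [Mw MwP] eps N eps0.
apply: contrapT => never.
pose m := Num.min 2 kappa; have m0 : 0 < m by rewrite lt_min kappa_gt0 ltr0n.
have TN0 : (0 < T0 + N)%N by rewrite addn_gt0 T00.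
have [N1] := alpha_dvg Mw (mulr_gt0 m0 eps0) TN0.
rewrite ltNge => /negP; apply.
apply: (@le_trans _ _ (\sum_(T0 + N <= t < N1 + T0) (gain delta i0 c t w + spread i0 t w))).
  have hi t : (T0 + N <= t)%N -> m * eps * alpha t <= gain delta i0 c t w + spread i0 t w.
    move=> Tt; have t0 : (0 < t)%N := leq_trans TN0 Tt.
    have a0 := alpha_gt0 t0.
    have gap0 : 0 <= global_cost r f (x t i0 w) - global_cost r f c by rewrite subr_ge0.
    have g1 := gain_ge i0 c w t0; have s0 := spread_ge0 i0 w t0.
    have g0 := gain_ge0 i0 w t0 cmin.
    have [gap|gap] := ltP (global_cost r f (x t i0 w) - global_cost r f c) eps.
      have far : eps <= wdist r (x t ^~ w) (x t i0 w).
        rewrite leNgt; apply/negP => near_; apply: never; exists t => //.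
        by apply: leq_trans Tt; exact: leq_addl.
      have : m * eps * alpha t <= spread i0 t w.
        apply: (@le_trans _ _ (kappa * alpha t * eps)).
          rewrite mulrAC ler_wpM2r ?(ltW eps0)// ler_wpM2r ?(ltW a0)//.
          by rewrite ge_min lexx orbT.
        by apply: ler_pM; rewrite ?mulr_ge0 ?(ltW a0) ?(ltW eps0) ?(ltW kappa_gt0) ?alpha_beta.
      by lra.
    have : m * eps * alpha t <= 2 * alpha t * (global_cost r f (x t i0 w) - global_cost r f c).
      rewrite mulrAC; apply: ler_pM; rewrite ?mulr_ge0 ?(ltW a0) ?(ltW eps0) ?(ltW m0)//.
      by rewrite ler_wpM2r ?(ltW a0)// ge_min lexx.
    by lra.
  have [N1s|N1s] := leqP N1 (T0 + N).
    rewrite big_geq// big_nat_cond sumr_ge0// => t /andP[/andP[Tt _] _].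
    have t0 : (0 < t)%N := leq_trans TN0 Tt.
    by rewrite addr_ge0 ?gain_ge0 ?spread_ge0.
  rewrite (@big_cat_nat _ _ _ N1 (T0 + N) (N1 + T0)) ?leq_addr//=; last exact: ltnW.
  rewrite -[leLHS]addr0 lerD//.
    by rewrite big_nat_cond [leRHS]big_nat_cond;
      apply: ler_sum => t /andP[/andP[Tt _] _]; exact: hi.
  rewrite big_nat_cond sumr_ge0// => t /andP[/andP[Tt _] _].
  have t0 : (0 < t)%N := leq_trans (ltn_trans TN0 N1s) Tt.
  by rewrite addr_ge0 ?gain_ge0 ?spread_ge0.
apply: le_trans (MwP N1); rewrite (sum_ord_shift (fun t => gain delta i0 c t w + spread
  i0 t w)).
have tpos t : (T0 <= t)%N -> 0 <= gain delta i0 c t w + spread i0 t w.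
  move=> Tt; have t0 : (0 < t)%N := leq_trans T00 Tt.
  by rewrite addr_ge0 ?gain_ge0 ?spread_ge0.
by apply: ler_sum_nat_widen; rewrite ?leq_addr.
Qed.

Theorem ae_cvg_to_minimizer (i0 : 'I_n) : argmin (global_cost r f) !=set0 ->
  {ae P, forall w, exists2 p, argmin (global_cost r f) p &
    forall i, (fun t => x t i w) @ \oo --> p}.
Proof.
move=> [c0 c0min].
have [k [c [cmin span]]] := affine_basis (argmin (global_cost r f)).
have all_cvg : {ae P, forall w, forall j, cvgn (fun t => dist2 (c j) t w)}.
  have : {ae P, forall w, forall m : nat, forall j : 'I_k, m = j ->
      cvgn (fun t => dist2 (c j) t w)}.
    apply/ae_foralln => m; have [mk|km] := ltnP m k.
      apply: filterS (dist2_cvg i0 (cmin (Ordinal mk))) => w cw j mj.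
      by rewrite (_ : j = Ordinal mk)//; apply: val_inj.
    by apply: aeW => w j mj; have := ltn_ord j; rewrite -mj ltnNge km.
  by apply: filterS => w cw j; exact: cw.
apply: filterS2 all_cvg (near_optimal_infinitely_often i0 c0min) => w cw freq.
apply: (cvg_to_minimizer r_gt0 r_sum1 fg gL (x := fun t i => x t i w) c0min) => //.
  move=> a /span[lam lam1 ->].
  exact: (cvg_wdist_affine r_sum1 (x := fun t i => x t i w) lam1 cw).
exact: freq.
Qed.

End mean_descent.

(** * Polynomially decaying step sizes *)
Section stepsizes.
Context {R : realType}.

Lemma powR_nat_ge2 (mu : R) (t : nat) : 1 / 2 < mu -> (4 <= t)%N -> 2 <= t%:R `^ mu.
Proof.
move=> mu_gt t4; have mu0 : 0 <= mu by lra.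
have two : (2 : R) = 4 `^ 2^-1.
  rewrite powR12_sqrt// -[LHS]ger0_norm// -sqrtr_sqr; congr Num.sqrt; ring.
rewrite {1}two; apply: (@le_trans _ _ (4 `^ mu)).
  by rewrite ler_powR ?ler1n//; lra.
by rewrite ge0_ler_powR ?nnegrE ?ler0n// ler_nat.
Qed.

Lemma beta_sqr_sum (beta0 mu : R) : 1 / 2 < mu -> exists S : R, forall N,
  \sum_(1 <= t < N) (beta0 / t%:R `^ mu) ^+ 2 <= S.
Proof.
move=> mu_gt; have p1 : 1 < mu + mu by lra.
have [S SP] := sum_inv_powR_le p1; exists (beta0 ^+ 2 * S) => N.
apply: le_trans (ler_wpM2l (sqr_ge0 beta0) (SP N)).
rewrite mulr_sumr big_nat_cond [leRHS]big_nat_cond; apply: ler_sum => t /andP[/andP[t0 _] _].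
rewrite powRD; last by apply/implyP => _; rewrite pnatr_eq0 -lt0n.
by rewrite -expr2 exprMn exprVn.
Qed.

Lemma alpha_sqr_div_beta_sum (alpha0 beta0 mu nu : R) : 0 < beta0 ->
  1 / 2 * (1 + mu) < nu -> exists S : R, forall N,
  \sum_(1 <= t < N) (alpha0 / t%:R `^ nu) ^+ 2 / (beta0 / t%:R `^ mu) <= S.
Proof.
move=> beta00 nu_gt; have p1 : 1 < nu + nu - mu by lra.
have [S SP] := sum_inv_powR_le p1; exists (alpha0 ^+ 2 / beta0 * S) => N.
have ab0 : 0 <= alpha0 ^+ 2 / beta0 by rewrite divr_ge0 ?sqr_ge0 ?ltW.
apply: le_trans (ler_wpM2l ab0 (SP N)).
rewrite mulr_sumr big_nat_cond [leRHS]big_nat_cond; apply: ler_sum => t /andP[/andP[t0 _] _].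
have tn0 : t%:R != 0 :> R by rewrite pnatr_eq0 -lt0n.
have tp p : t%:R `^ p != 0 :> R by rewrite gt_eqF// powR_gt0// ltr0n.
rewrite powRB ?tn0 ?implybT// powRD ?tn0 ?implybT//.
rewrite le_eqVlt; apply/orP; left; apply/eqP; field.
by rewrite !tp gt_eqF.
Qed.

End stepsizes.

Theorem proposition1 (R : realType) (disp : measure_display)
    (T : measurableType disp) (P : probability T R)
    (n d : nat) (n_ge2 : (2 <= n)%N) (d_ge1 : (1 <= d)%N)
    (r : 'cV[R]_n) (r_gt0 : forall i, 0 < r i 0)
    (r_sum1 : \sum_(i < n) r i 0 = 1)
    (E : nat -> {set 'I_n * 'I_n}) (W : nat -> 'M[R]_n)
    (WE : forall t i j, (0 < t)%N -> 0 < W t i j <-> (j, i) \in E t)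
    (f : 'I_n -> 'rV[R]_d -> R) (g : 'I_n -> 'rV[R]_d -> 'rV[R]_d)
    (fg : forall i u, is_subgradient (f i) u (g i u))
    (alpha0 beta0 mu nu : R) (alpha0_gt0 : 0 < alpha0) (beta0_gt0 : 0 < beta0)
    (alpha beta : nat -> R)
    (alphaE : forall t, (0 < t)%N -> alpha t = alpha0 / (t%:R `^ nu))
    (betaE : forall t, (0 < t)%N -> beta t = beta0 / (t%:R `^ mu))
    (x xhat e : nat -> 'I_n -> T -> 'rV[R]_d) (x1 : 'I_n -> 'rV[R]_d)
    (x_random : forall t i, (0 < t)%N -> random_matrix (x t i))
    (e_random : forall t i, (0 < t)%N -> random_matrix (e t i))
    (x_init : forall i w, x 1%N i w = x1 i)
    (xhatE : forall t i w, (0 < t)%N ->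
       xhat t i w = \sum_(j < n) W t i j *: x t j w + e t i w)
    (dynamics : forall t i w, (0 < t)%N ->
       x t.+1 i w = (1 - beta t) *: x t i w + beta t *: xhat t i w
                    - alpha t *: g i (x t i w))
    (noise : noise_assumption P
       (natural_filtration (fun t w => \matrix_(i < n) x t i w)) e)
    (connectivity : connectivity_assumption W E r)
    (objective : objective_assumption r f)
    (beta0_le1 : beta0 <= 1)
    (mu_gt : 1 / 2 < mu) (mu_le1 : mu <= 1)
    (nu_gt : 1 / 2 * (1 + mu) < nu) (nu_le1 : nu <= 1) :
  exists2 xt : T -> 'rV[R]_d, random_matrix xt &
    {ae P, forall w, argmin (global_cost r f) (xt w) /\
       forall i, (fun t => x t i w) @ \oo --> xt w}.
Proof.
have mu0 : 0 <= mu by lra.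
have nu0 : 0 <= nu by lra.
have [Wst [eta eta0 Weta] [B B0 conn]] := connectivity.
have [_ argmin0 [L L0 gL']] := objective.
have [gamma gamma0 noiseP] := noise.
have W_ge0 t i j : (0 < t)%N -> 0 <= W t i j by move=> /Wst[].
have W_row t i : (0 < t)%N -> \sum_j W t i j = 1.
  move=> /Wst[_ + _] => /matrixP/(_ i 0); rewrite !mxE => <-.
  by apply: eq_bigr => j _; rewrite mxE mulr1.
have W_col t j : (0 < t)%N -> \sum_i r i 0 * W t i j = r j 0.
  move=> /Wst[_ _] /matrixP/(_ 0 j); rewrite !mxE => <-.
  by apply: eq_bigr => i _; rewrite mxE.
have W_eta i j t : (0 < t)%N -> (j, i) \in E t -> eta <= W t i j.
  by move=> t0 ji; apply: Weta => //; apply/WE.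
have gL i u : enorm (g i u) <= L by apply/ltW/(gL' i u); exact: fg.
have gL2 i u : sq (g i u) <= L ^+ 2.
  by rewrite -enorm_sqr ler_sqr ?nnegrE ?enorm_ge0 ?(ltW L0).
have tR0 (t : nat) : (0 < t)%N -> 0 < t%:R :> R by rewrite ltr0n.
have alpha_gt0 t : (0 < t)%N -> 0 < alpha t.
  by move=> t0; rewrite alphaE// divr_gt0// powR_gt0 ?tR0.
have beta_gt0 t : (0 < t)%N -> 0 < beta t.
  by move=> t0; rewrite betaE// divr_gt0// powR_gt0 ?tR0.
have beta_noninc s t : (0 < s <= t)%N -> beta t <= beta s.
  move=> /andP[s0 st]; have t0 := leq_trans s0 st.
  rewrite !betaE// ler_pM2l// lef_pV2 ?posrE ?powR_gt0 ?tR0//.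
  by rewrite ge0_ler_powR ?nnegrE ?ler0n// ler_nat.
have beta_le1 t : (0 < t)%N -> beta t <= 1.
  move=> t0; apply: (le_trans (beta_noninc 1%N t _)) => //.
  by rewrite betaE// powR1 divr1.
(* [4 `^ mu >= 2], so [beta <= 1 / 2] from time 4 on; the summand [B] leaves room
   for a window in the past *)
have beta_half t : (B + 4 <= t)%N -> beta t <= 1 / 2.
  move=> Bt; have t0 : (0 < t)%N by rewrite (leq_trans _ Bt)// addnS.
  have t4 : (4 <= t)%N := leq_trans (leq_addl B 4) Bt.
  rewrite betaE// ler_pdivrMr ?powR_gt0 ?tR0//.
  by have := powR_nat_ge2 mu_gt t4; lra.
pose kappa := beta0 / alpha0; have kappa0 : 0 < kappa by rewrite divr_gt0.
have alpha_beta t : (0 < t)%N -> kappa * alpha t <= beta t.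
  move=> t0; rewrite alphaE// betaE// mulrA divfK ?gt_eqF// ler_pM2l//.
  rewrite lef_pV2 ?posrE ?powR_gt0 ?tR0// ler_powR ?ler1n//; lra.
have alpha_dvg c M N0 : 0 < c -> (0 < N0)%N -> exists N, M < \sum_(N0 <= t < N) c * alpha t.
  move=> c0 N00; have nu01 : 0 <= nu <= 1 by rewrite nu0.
  have [N NP] := sum_inv_powR_unbounded M N0 nu01 (mulr_gt0 c0 alpha0_gt0).
  exists N; apply: (lt_le_trans NP).
  rewrite big_nat_cond [leRHS]big_nat_cond; apply: ler_sum => t /andP[/andP[t0 _] _].
  by rewrite alphaE ?mulrA// (leq_trans N00).
have [S1 S1P] := beta_sqr_sum beta0 mu_gt.
have [S2 S2P] := alpha_sqr_div_beta_sum alpha0 beta0_gt0 nu_gt.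
have err_sum N : \sum_(1 <= t < N) (beta t ^+ 2 + alpha t ^+ 2 / beta t) <= S1 + S2.
  apply: le_trans (lerD (S1P N) (S2P N)); rewrite -big_split/=.
  rewrite big_nat_cond [leRHS]big_nat_cond; apply: ler_sum => t /andP[/andP[t0 _] _].
  by rewrite betaE// alphaE.
have dyn t i w : (0 < t)%N -> x t.+1 i w = stepped (W t) (alpha t) (beta t)
    (x t ^~ w) (e t ^~ w) (fun i => g i (x t i w)) i.
  by move=> t0; rewrite dynamics// xhatE// scalerDr addrA.
have [K K0 window] := disagreement_window (d := d) L alpha r_gt0 r_sum1 W_ge0 W_row eta0
  W_eta conn
  (fun t t0 => ltW (beta_gt0 t t0)) beta_le1.
have e_centred t i k A : (0 < t)%N -> <<s past x t >> A ->
    \int[P]_(w in A) e t i w 0 k = 0.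
  move=> t0 HA; have [/(_ k)[_ _ _ /(_ A HA) E0] _] := noiseP i t t0.
  by rewrite /Rintegral E0 integral0.
have e_int t i : (0 < t)%N -> intg P (fun w => enorm (e t i w) ^+ 2).
  by move=> t0; have [_ [Y [iY _ _ _] _]] := noiseP i t t0.
have e_var t i : (0 < t)%N -> \int[P]_w (enorm (e t i w) ^+ 2) <= gamma.
  move=> t0; have [_ [Y [ie iY _ EY] Yg]] := noiseP i t t0.
  rewrite /Rintegral EY; last exact: (@measurableT _ (g_sigma_algebraType (past x t))).
  rewrite -/(Rintegral P setT Y).
  have mY := intg_meas iY.
  have mYg : measurable_fun [set: T] (fun w => Num.min (Y w) gamma).
    exact: measurable_minr.
  have EYg : \int[P]_w Y w = \int[P]_w Num.min (Y w) gamma.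
    congr fine; apply: ae_eq_integral => //; [exact/measurable_EFinP|exact/measurable_EFinP|].
    by apply: filterS Yg => w Ywg _; rewrite /Num.min; case: ltgtP Ywg => // ->.
  have iYg : intg P (fun w => Num.min (Y w) gamma).
    apply: (intg_le (k := fun w => `|Y w| + gamma)) => //.
      by apply: intgD; [exact: (integrable_abse iY)|exact: (intg_cst P gamma)].
    move=> w; rewrite /Num.min; case: ltP => _.
      by rewrite lerDl ltW.
    by rewrite gtr0_norm// lerDr.
  have cstE : \int[P]_w (cst gamma w) = gamma.
    rewrite /cst Rintegral_cst//.
    have -> : fine (P [set: T]) = 1 by rewrite probability_setT.
    by rewrite mulr1.
  rewrite EYg -[leRHS]cstE; apply: le_Rintegral => //; first exact: (intg_cst P gamma).
  by move=> w _; rewrite ge_min lexx orbT.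
have i0 : 'I_n by exact: (Ordinal (leq_trans (ltnW (ltnSn 1)) n_ge2)).
have T0_ge : (B.+2 <= B + 4)%N by rewrite -addn2 leq_add2l.
(* outside a measurable null set [N0] the limit is a pointwise limit of the
   measurable functions [x t.+1 i0 w 0 k * \1_(~` N0) w] *)
have [N0 [mN0 N00 N0P]] : {ae P, forall w, exists2 p, argmin (global_cost r f) p &
    forall i, (fun t => x t i w) @ \oo --> p}.
  apply: (ae_cvg_to_minimizer (x1 := x1) (e := e) r_gt0 r_sum1 W_ge0 W_row W_col gL
    alpha_gt0 beta_gt0 beta_le1 x_random e_random x_init dyn e_centred e_int e_var fg K0
    _ beta_noninc T0_ge beta_half err_sum alpha_dvg kappa0 alpha_beta i0 argmin0).
  move=> w i1 t Bt.
  apply: (window (fun s i => x s i w) (fun s i => e s i w) (fun s i => g i (x s i w))) => //.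
  by move=> s i s0; exact: dyn.
have /choice[xt xtP] w : exists p, (N0 w -> p = 0) /\ (~ N0 w ->
    argmin (global_cost r f) p /\ forall i, (fun t => x t i w) @ \oo --> p).
  have [wN|wN] := pselect (N0 w); first by exists 0.
  have [p pmin px] : exists2 p, argmin (global_cost r f) p &
      forall i, (fun t => x t i w) @ \oo --> p.
    by apply: contrapT => nx; apply: wN; apply: N0P.
  by exists p; split.
exists xt; last first.
  exists N0; split => // w /= nw; apply: contrapT => wN; apply: nw.
  by have [_ /(_ wN)] := xtP w.
move=> a k; rewrite (ord1 a).
apply: (measurable_fun_cvg (h := fun t w => x t.+1 i0 w 0 k * \1_(~` N0) w)) => //.
  move=> t; apply: measurable_funM; first exact: x_random.
  exact: measurable_indic (measurableC mN0).
move=> w _; have [wN|wN] := pselect (N0 w).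
  have [-> // _] := xtP w; rewrite mxE [X in X @ _ --> _](_ : _ = cst 0); first exact: cvg_cst.
  by apply/funext => t /=; rewrite indicE memNset ?mulr0//= => /(_ wN).
have [_ /(_ wN)[_ /(_ i0) xw]] := xtP w.
rewrite [X in X @ _ --> _](_ : _ = (fun t => x t.+1 i0 w 0 k)); last first.
  by apply/funext => t /=; rewrite indicE mem_set ?mulr1.
rewrite (_ : (fun t => x t.+1 i0 w 0 k) = (fun t => x (t + 1)%N i0 w 0 k)); last first.
  by apply/funext => t; rewrite addn1.
rewrite (cvg_shiftn 1 (fun t => x t i0 w 0 k)).
apply/cvgrPdist_le => eps eps0; move/cvgrPdist_le : xw => /(_ _ eps0).
apply: filterS => t; apply: le_trans.
by have := coord_le_norm (xt w - x t i0 w) k; rewrite !mxE.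
Qed.
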